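(* Let $G$ be a purely non-abelian finite group. Then, with the subgroups $\Lambda(G)$ and $K=\mathrm{SpAut}_c(G)\ltimes\mathrm{Hom}(G,\widehat{G})$ of $\mathrm{Aut}(\mathcal{D}(G))$, there are exact factorizations $$\mathrm{Aut}(\mathcal{D}(G))=\Lambda(G)\,K=K\,\Lambda(G).$$ Consequently $$|\mathrm{Aut}(\mathcal{D}(G))|=|\mathrm{End}(Z(G))|\cdot|\mathrm{Hom}(G,\widehat{G})|\cdot|\mathrm{Aut}_c(G)|\cdot|\mathrm{Aut}(G)|.$$
   Context: The base field $\mathbbm{k}$ is algebraically closed of characteristic zero. For a finite group $G$, $\mathbbm{k}^G$ is the linear dual of $\mathbbm{k}G$, with dual basis $\{e_g\}_{g\in G}$ and identity $\varepsilon=\sum_{g}e_g$; $\widehat{G}=\mathrm{Hom}(G,\mathbbm{k}^\times)$ is the group of group-like elements of $\mathbbm{k}^G$. The Drinfeld double $\mathcal{D}(G)$ is the Hopf algebra with basis $e_g\# h$ ($g,h\in G$), multiplication $(e_g\# g')(e_h\# h')=\delta_{g,\,g'hg'^{-1}}\,e_g\# g'h'$, unit $\varepsilon\# 1$, and coalgebra structure $(\mathbbm{k}^G)^{\mathrm{cop}}\otimes\mathbbm{k}G$. $\mathrm{Aut}(\mathcal{D}(G))$ is its group of Hopf algebra automorphisms. Every Hopf algebra endomorphism $\psi$ of $\mathcal{D}(G)$ is determined by its components $(p,u,r,v)$, where $u(a)=(\mathrm{id}\otimes\varepsilon)\psi(a\#1)\in\mathbbm{k}^G$, $p(a)=(\mathrm{ev}_1\otimes\mathrm{id})\psi(a\#1)\in\mathbbm{k}G$,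 $r(g)=(\mathrm{id}\otimes\varepsilon)\psi(\varepsilon\# g)\in\widehat{G}$, $v(g)=(\mathrm{ev}_1\otimes\mathrm{id})\psi(\varepsilon\# g)\in G$ for $a\in\mathbbm{k}^G$, $g\in G$ (here $\mathrm{ev}_1(f)=f(1)$ and $\varepsilon$ in the second tensor factor is the counit of $\mathbbm{k}G$); one has $\psi(a\# g)=u(a_{(1)})r(g)\# p(a_{(2)})v(g)$, with Sweedler notation in $(\mathbbm{k}^G)^{\mathrm{cop}}$. Trivial $p$ means $p(a)=a(1)1_G$; trivial $r$ means $r(g)=\varepsilon$ for all $g$. $\Lambda(G)$ is the set of automorphisms with $u=\mathrm{id}$, $v=\mathrm{id}$ and $r$ trivial. $K$ is the subgroup of all automorphisms with $p$ trivial; it is the semidirect product of the subgroup $\mathrm{SpAut}_c(G)$, consisting of the maps $e_g\# h\mapsto e_{w(g)}\# v(h)$ with $w,v\in\mathrm{Aut}(G)$ and $w^{-1}v\in\mathrm{Aut}_c(G)$, and the normal subgroup $\mathrm{Hom}(G,\widehat{G})$, consisting of the maps $e_g\# h\mapsto r(h)e_g\# h$. Here $\mathrm{Aut}_c(G)=\{\phi\in\mathrm{Aut}(G):\phi(g)g^{-1}\in Z(G)\ \forall g\}$. A group is purely non-abelian if it has no non-trivial abelian direct factor. An exact factorization of a group $X$ is a pair of subgroups $Y,Z$ with $X=YZ$ and $Y\cap Z=1$. *)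

(* Defs.v *)
From HB Require Import structures.
From mathcomp Require Import all_boot all_algebra all_fingroup all_solvable.
From mathcomp Require Import boolp classical_sets functions cardinality finmap.

Set Implicit Arguments.
Unset Strict Implicit.
Unset Printing Implicit Defensive.

Import GRing.Theory.
Local Open Scope ring_scope.
Local Open Scope classical_set_scope.

Section DrinfeldDouble.
Variables (k : fieldType) (gT : finGroupType).

(* Carrier of both k^G and kG, for G = [set: gT]: a function gT -> k is an
   element of k^G, and is also the list of coordinates of an element of kG. *)
Local Notation kfun := {ffun gT -> k^o}.

(* e_g in k^G, and also the group element g in kG *)
Definition delta (g : gT) : kfun := [ffun x => (x == g)%:R].

(* epsilon = \sum_g e_g, the unit of k^G *)
Definition kone : kfun := [ffun=> 1].

(* x (g, h) is the coefficient of e_g # h in x. *)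
Local Notation dbl := {ffun gT * gT -> k^o}.
Local Notation dbl2 := {ffun (gT * gT) * (gT * gT) -> k^o}.

Definition smash (a b : kfun) : dbl := [ffun s => a s.1 * b s.2].

Definition dbas (s : gT * gT) : dbl := smash (delta s.1) (delta s.2).

Definition tens (x y : dbl) : dbl2 := [ffun s => x s.1 * y s.2].

Definition tens_map (f : dbl -> dbl) (t : dbl2) : dbl2 :=
  \sum_s \sum_s' t (s, s') *: tens (f (dbas s)) (f (dbas s')).

(* (e_g # g') (e_h # h') *)
Definition dmul_bas (s t : gT * gT) : dbl :=
  if s.1 == (s.2 * t.1 * s.2^-1)%g then dbas (s.1, s.2 * t.2)%g else 0.

Definition dmul (x y : dbl) : dbl :=
  \sum_s \sum_t (x s * y t) *: dmul_bas s t.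

Definition dunit : dbl := smash kone (delta 1%g).

(* The coproduct of k^G is e_g |-> \sum_(a b = g) e_a (x) e_b; its factors are
   swapped here because of the co-opposite. *)
Definition dcomul_bas (s : gT * gT) : dbl2 :=
  \sum_(ab : gT * gT | (ab.1 * ab.2)%g == s.1)
    tens (dbas (ab.2, s.2)) (dbas (ab.1, s.2)).

Definition dcomul (x : dbl) : dbl2 := \sum_s x s *: dcomul_bas s.

(* counit: e_g # h |-> e_g(1) *)
Definition dcounit (x : dbl) : k := \sum_h x (1%g, h).

(* antipode: e_g # h |-> (epsilon # h^-1) (e_(g^-1) # 1)
                       = e_(h^-1 g^-1 h) # h^-1 *)
Definition dantipode (x : dbl) : dbl :=
  \sum_s x s *: dbas (s.2^-1 * s.1^-1 * s.2, s.2^-1)%g.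

Definition hopf_endo (f : 'End(dbl)) : Prop :=
  [/\ f dunit = dunit,
      forall x y, f (dmul x y) = dmul (f x) (f y),
      forall x, dcounit (f x) = dcounit x,
      forall x, dcomul (f x) = tens_map f (dcomul x)
    & forall x, dantipode (f x) = f (dantipode x)].

Definition hopf_aut (f : 'End(dbl)) : Prop := hopf_endo f /\ bijective f.

Record haut : Type := HAut { haut_val :> 'End(dbl);
                             _ : `[< hopf_aut haut_val >] }.
HB.instance Definition _ := [isSub for haut_val].
HB.instance Definition _ := [Choice of haut by <:].

Lemma hautP (f : haut) : hopf_aut f.
Proof. by case: f => f /= /asboolP. Qed.

Definition mkhaut (f : 'End(dbl)) (fP : hopf_aut f) : haut :=
  HAut (asboolT fP).

Lemma tensDl x x' y : tens (x + x') y = tens x y + tens x' y.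
Proof. by apply/ffunP=> s; rewrite !ffunE mulrDl. Qed.
Lemma tensDr x y y' : tens x (y + y') = tens x y + tens x y'.
Proof. by apply/ffunP=> s; rewrite !ffunE mulrDr. Qed.
Lemma tensZl c x y : tens (c *: x) y = c *: tens x y.
Proof. by apply/ffunP=> s; rewrite !ffunE /= -mulrA. Qed.
Lemma tensZr c x y : tens x (c *: y) = c *: tens x y.
Proof. by apply/ffunP=> s; rewrite !ffunE /= mulrCA. Qed.

Lemma dbasE s t : dbas s t = (t == s)%:R.
Proof.
by case: s t => [a b] [c d]; rewrite !ffunE /= -natrM mulnb xpair_eqE.
Qed.

Lemma dbl_sum (x : dbl) : x = \sum_s x s *: dbas s.
Proof.
apply/ffunP=> t; rewrite sum_ffunE (bigD1 t) //= big1 ?addr0 => [|s nst].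
  by rewrite ffunE dbasE eqxx [_ *: _]mulr1.
by rewrite ffunE dbasE eq_sym (negPf nst) [_ *: _]mulr0.
Qed.

Lemma tens_suml (I : finType) (F : I -> dbl) y :
  tens (\sum_i F i) y = \sum_i tens (F i) y.
Proof.
apply/ffunP=> s; rewrite ffunE !sum_ffunE mulr_suml.
by apply: eq_bigr => i _; rewrite ffunE.
Qed.

Lemma tens_sumr (I : finType) (F : I -> dbl) y :
  tens y (\sum_i F i) = \sum_i tens y (F i).
Proof.
apply/ffunP=> s; rewrite ffunE !sum_ffunE mulr_sumr.
by apply: eq_bigr => i _; rewrite ffunE.
Qed.

Lemma tens_map_sum (I : finType) f (F : I -> dbl2) :
  tens_map f (\sum_i F i) = \sum_i tens_map f (F i).
Proof.
rewrite /tens_map [RHS]exchange_big /=; apply: eq_bigr => s _.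
rewrite [RHS]exchange_big /=; apply: eq_bigr => s' _.
by rewrite sum_ffunE scaler_suml.
Qed.

Lemma tens_mapZ f c (t : dbl2) : tens_map f (c *: t) = c *: tens_map f t.
Proof.
rewrite /tens_map scaler_sumr; apply: eq_bigr => s _.
by rewrite scaler_sumr; apply: eq_bigr => s' _; rewrite ffunE scalerA.
Qed.

Lemma tens_map_tens (f : 'End(dbl)) x y :
  tens_map f (tens x y) = tens (f x) (f y).
Proof.
rewrite [x in RHS]dbl_sum [y in RHS]dbl_sum !linear_sum tens_suml.
apply: eq_bigr => s _; rewrite tens_sumr; apply: eq_bigr => s' _.
by rewrite !linearZ /= tensZl tensZr scalerA ffunE.
Qed.

Lemma tens_map_comp (f g : 'End(dbl)) t :
  tens_map (f \o g)%VF t = tens_map f (tens_map g t).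
Proof.
rewrite [tens_map g t]/tens_map tens_map_sum;  apply: eq_bigr => s _.
rewrite tens_map_sum; apply: eq_bigr => s' _.
by rewrite tens_mapZ tens_map_tens !comp_lfunE.
Qed.

Lemma tens_map_id t : tens_map (\1%VF : 'End(dbl)) t = t.
Proof.
apply/ffunP=> -[a b]; rewrite sum_ffunE (bigD1 a) //= sum_ffunE (bigD1 b) //=.
rewrite !big1 ?addr0 => [|s nsa|s nsb].
- by rewrite !ffunE !id_lfunE !dbasE !eqxx mulr1 [_ *: _]mulr1.
- rewrite sum_ffunE big1 // => s' _.
  by rewrite !ffunE !id_lfunE !dbasE eq_sym (negPf nsa) mul0r [_ *: _]mulr0.
by rewrite !ffunE !id_lfunE !dbasE [b == _]eq_sym (negPf nsb) mulr0 [_ *: _]mulr0.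
Qed.

Lemma hopf_aut_id : hopf_aut \1%VF.
Proof.
split; last by exists id => x; rewrite id_lfunE.
by split=> *; rewrite ?tens_map_id !id_lfunE.
Qed.

Lemma hopf_aut_comp f g : hopf_aut f -> hopf_aut g -> hopf_aut (f \o g)%VF.
Proof.
move=> [[f1 fM fe fD fS] fb] [[g1 gM ge gD gS] gb]; split.
  split=> [|x y|x|x|x]; rewrite ?tens_map_comp !comp_lfunE.
  - by rewrite g1.
  - by rewrite gM fM.
  - by rewrite fe.
  - by rewrite fD gD.
  by rewrite fS gS.
apply: (eq_bij (bij_comp fb gb)) => x.
by rewrite comp_lfunE.
Qed.

Lemma hopf_aut_ker f : hopf_aut f -> lker f == 0%VS.
Proof. by case=> _ /bij_inj fi; apply/lker0P. Qed.

Lemma hopf_aut_inv f : hopf_aut f -> hopf_aut (f^-1)%VF.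
Proof.
move=> fA; have [[f1 fM fe fD fS] fb] := fA; have k0 := hopf_aut_ker fA.
have fK := lker0_lfunK k0; have fKV := lker0_lfunVK k0; have fi := bij_inj fb.
split; last by exists f.
split=> [|x y|x|x|x].
- by apply: fi; rewrite fKV.
- by apply: fi; rewrite fM !fKV.
- by rewrite -fe fKV.
- rewrite -{2}[x]fKV fD -tens_map_comp.
  by rewrite lker0_compVf // tens_map_id.
- by apply: fi; rewrite -fS !fKV.
Qed.

Definition haut_one : haut := mkhaut hopf_aut_id.
Definition haut_mul (f g : haut) : haut :=
  mkhaut (hopf_aut_comp (hautP f) (hautP g)).
Definition haut_inv (f : haut) : haut := mkhaut (hopf_aut_inv (hautP f)).

Lemma haut_mulA : associative haut_mul.
Proof. by move=> f g h; apply: val_inj; rewrite /= comp_lfunA. Qed.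
Lemma haut_mul1 : left_id haut_one haut_mul.
Proof. by move=> f; apply: val_inj; rewrite /= comp_lfun1l. Qed.
Lemma haut_mulr1 : right_id haut_one haut_mul.
Proof. by move=> f; apply: val_inj; rewrite /= comp_lfun1r. Qed.
Lemma haut_mulV : left_inverse haut_one haut_inv haut_mul.
Proof.
move=> f; apply: val_inj.
by rewrite /= lker0_compVf // (hopf_aut_ker (hautP f)).
Qed.
Lemma haut_mulrV : right_inverse haut_one haut_inv haut_mul.
Proof.
move=> f; apply: val_inj.
by rewrite /= lker0_compfV // (hopf_aut_ker (hautP f)).
Qed.

HB.instance Definition _ :=
  isGroup.Build haut haut_mulA haut_mul1 haut_mulr1 haut_mulV haut_mulrV.

(* (id (x) epsilon) and (ev_1 (x) id) *)
Definition proj_fun (x : dbl) : kfun := [ffun g => \sum_h x (g, h)].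
Definition proj_grp (x : dbl) : kfun := [ffun h => x (1%g, h)].

(* The components of f; comp_p and comp_v take values in kG. *)
Definition comp_u (f : dbl -> dbl) (a : kfun) : kfun :=
  proj_fun (f (smash a (delta 1%g))).
Definition comp_p (f : dbl -> dbl) (a : kfun) : kfun :=
  proj_grp (f (smash a (delta 1%g))).
Definition comp_r (f : dbl -> dbl) (g : gT) : kfun :=
  proj_fun (f (smash kone (delta g))).
Definition comp_v (f : dbl -> dbl) (g : gT) : kfun :=
  proj_grp (f (smash kone (delta g))).

Definition trivial_p (f : dbl -> dbl) : Prop :=
  forall a, comp_p f a = a 1%g *: delta 1%g.
Definition trivial_r (f : dbl -> dbl) : Prop :=
  forall g, comp_r f g = kone.

(* \widehat{G} = Hom(G, k^* ) *)
Definition dual_group : set kfun :=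
  [set chi | (forall g, chi g != 0) /\
             (forall g h, chi (g * h)%g = chi g * chi h)].

Definition Hom_dual : set {ffun gT -> kfun} :=
  [set r | (forall g, dual_group (r g)) /\
           (forall g h x, r (g * h)%g x = r g x * r h x)].

Definition Autc : {set {perm gT}} :=
  [set a in Aut [set: gT]%SET | [forall g, (a g * g^-1)%g \in 'Z([set: gT]%SET)%g]]%SET.

Definition Lambda : set haut :=
  [set f | [/\ forall a, comp_u f a = a,
               forall g, comp_v f g = delta g
             & trivial_r f]].

Definition KAut : set haut := [set f | trivial_p f].

(* Products of permutations are read from left to right, hence w^-1 o v is
   v * w^-1. *)
Definition SpAutc : set haut :=
  [set f | exists w v : {perm gT},
     [/\ w \in Aut [set: gT]%SET, v \in Aut [set: gT]%SET, (v * w^-1)%g \in Autc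
       & forall g h, f (dbas (g, h)) = dbas (w g, v h)]].

Definition HomAut : set haut :=
  [set f | exists2 r, Hom_dual r &
     forall g h, f (dbas (g, h)) = r h g *: dbas (g, h)].

End DrinfeldDouble.

Arguments Hom_dual : clear implicits.
Arguments Lambda : clear implicits.
Arguments KAut : clear implicits.
Arguments SpAutc : clear implicits.
Arguments HomAut : clear implicits.
Arguments Autc : clear implicits.

Section Groups.
Variable X : groupType.

Definition prod_set (Y Z : set X) : set X :=
  [set x | exists y z, [/\ Y y, Z z & x = (y * z)%g]].

Definition exact_factorization (Y Z : set X) : Prop :=
  [/\ group_closed [in Y], group_closed [in Z], [set: X] = prod_set Y Z
    & Y `&` Z = [set 1%g]].

(* K is the internal semidirect product of H and its normal subgroup N. *)
Definition internal_semidirect (K H N : set X) : Prop :=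
  [/\ group_closed [in K], group_closed [in H], group_closed [in N]
    & [/\ N `<=` K, forall x n, K x -> N n -> N (x * n * x^-1)%g,
          K = prod_set H N & H `&` N = [set 1%g]]].

End Groups.

Definition purely_nonabelian (gT : finGroupType) : Prop :=
  forall A B : {group gT}, (A \x B)%g = [set: gT]%SET -> abelian A -> A :=: 1%g.

Definition endos (gT : finGroupType) (A : {group gT}) :
    {set {ffun subg_of A -> subg_of A}} :=
  [set f : {ffun subg_of A -> subg_of A} |
     [forall x, forall y, f (x * y)%g == (f x * f y)%g]]%SET.

(* Main.v *)
From HB Require Import structures.
Require Import Defs.
From mathcomp Require Import all_boot all_algebra all_fingroup all_solvable.
From mathcomp Require Import separable cyclotomic.
From mathcomp Require Import boolp classical_sets functions cardinality finmap.

(* Write (p, u, r, v) and (p', u', r', v') for the components of an automorphism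
   psi and of its inverse. Comparing kG-components of psi psi' = id on
   group-likes gives g = p(r'(g)) v(v'(g)), where g |-> p(r'(g)) is a
   homomorphism to the centre. When G is purely non-abelian, Fitting's argument
   shows that such a central endomorphism has no non-trivial fixed point, so v'
   is injective. Dually, reading a = u(u'(a_1)) r(p'(a_2)) in the dual basis
   makes u'^* u^* a bijection of G; as the image of p'^* commutes with that of
   u'^*, it is central, and by equivariance p' takes values in k Z(G). Hence
   v^-1 p is a Hopf map factoring through the centre on both sides; it defines
   an element lambda of Lambda(G), and psi lambda^-1 has trivial p.
   Lambda(G) is thus the set of Hopf maps k^Z(G) -> k Z(G), and a nondegenerate
   symmetric pairing on Z(G) identifies these with End(Z(G)) by Fourier
   transform. *)

Set Implicit Arguments.
Unset Strict Implicit.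
Unset Printing Implicit Defensive.

Import GRing.Theory.
Local Open Scope ring_scope.

(** Fitting's argument concerns self-maps of a group, whereas [p] and [u] are linear maps on k^G.
    The way back to groups is that scalars forming a complete orthogonal system of idempotents are
    the indicator of a single index: this turns group-like elements into pairs (character, group
    element), and algebra maps k^G -> k^G into pullbacks along self-maps of G. Group-likes only see
    [p] on characters, and G may have few of them; hence the second, dual reading of psi psi' = id,
    which controls [p'] on all of k^G. The bijectivity obtained from each reading is what lets an
    invariance known along the image of a map be extended to the whole group. The pairing on Z(G) is
    a non-canonical identification of Z(G) with its character group; it rests on roots of unity and
    on |Z(G)| being invertible, both supplied by an algebraically closed field of characteristic
    zero. *)

(** * Sums against a Kronecker delta *)

Section Kronecker.
Variables (R : pzSemiRingType) (I : finType).

Lemma sum_kronl (a : I) (F : I -> R) : \sum_i (i == a)%:R * F i = F a.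
Proof.
by rewrite (bigD1 a) //= eqxx mul1r big1 ?addr0 // => i /negPf ->; rewrite mul0r.
Qed.

Lemma sum_kronr (a : I) (F : I -> R) : \sum_i F i * (i == a)%:R = F a.
Proof.
by rewrite (bigD1 a) //= eqxx mulr1 big1 ?addr0 // => i /negPf ->; rewrite mulr0.
Qed.

Lemma sum_kron (a : I) : \sum_i (i == a)%:R = 1 :> R.
Proof. by rewrite -[RHS](sum_kronl a (fun=> 1)); apply: eq_bigr => i _; rewrite mulr1. Qed.

Lemma sum_pair (J : finType) (F : I * J -> R) :
  \sum_s F s = \sum_i \sum_j F (i, j).
Proof. by rewrite pair_bigA; apply: eq_bigr => -[]. Qed.

End Kronecker.

(** * The structure maps of the double in coordinates *)

Section Coefficients.
Variables (k : fieldType) (gT : finGroupType).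
Implicit Types (g h s t : gT).
Local Notation kfun := {ffun gT -> k^o}.
Local Notation dbl := {ffun gT * gT -> k^o}.
Local Notation dbl2 := {ffun (gT * gT) * (gT * gT) -> k^o}.
Implicit Types (x y : dbl) (a b : kfun).

Lemma smashE a b g h : smash a b (g, h) = a g * b h :> k.
Proof. by rewrite ffunE. Qed.

Lemma tensE x y (p q : gT * gT) : tens x y (p, q) = x p * y q :> k.
Proof. by rewrite ffunE. Qed.

Lemma dunitE g h : dunit k gT (g, h) = (h == 1%g)%:R :> k.
Proof. by rewrite !ffunE mul1r. Qed.

Lemma dmul_basE (p q : gT * gT) g h :
  dmul_bas k p q (g, h) =
  ((p.1 == g) && (q == (p.2^-1 * g * p.2, p.2^-1 * h)%g))%:R :> k.
Proof.
case: p q => [p1 p2] [q1 q2] /=; rewrite /dmul_bas /= xpair_eqE.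
have -> : (q1 == (p2^-1 * g * p2)%g) = (g == (p2 * q1 * p2^-1)%g).
  by apply/eqP/eqP=> ->; rewrite !mulgA ?(mulgV, mulVg) mul1g ?(mulgK, mulgKV).
have -> : (q2 == (p2^-1 * h)%g) = (h == (p2 * q2)%g).
  by rewrite -(inj_eq (mulgI p2)) mulKVg eq_sym.
case: (eqVneq p1 g) => [->|ne] /=.
  by case: eqP => _; rewrite ?dbasE ?ffunE // xpair_eqE eqxx.
by case: eqP => _; rewrite ?dbasE ?ffunE // xpair_eqE eq_sym (negPf ne).
Qed.

Lemma dmulE x y g h :
  dmul x y (g, h) = \sum_c x (g, c) * y (c^-1 * g * c, c^-1 * h)%g :> k.
Proof.
rewrite /dmul sum_ffunE sum_pair exchange_big /=; apply: eq_bigr => c _.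
rewrite -[RHS](sum_kronl g (fun i => x (i, c) * y (c^-1 * g * c, c^-1 * h)%g)).
apply: eq_bigr => i _; rewrite sum_ffunE.
rewrite -[in RHS](sum_kronr (c^-1 * g * c, c^-1 * h)%g y) !mulr_sumr.
apply: eq_bigr => t _; rewrite ffunE dmul_basE /= -mulnb natrM.
by rewrite /GRing.scale /= mulrCA !mulrA.
Qed.

Lemma dcounitE x : dcounit x = \sum_h x (1%g, h).
Proof. by []. Qed.

(** The order [g2 * g1] reflects the co-opposite coproduct of k^G, and the Kronecker factor says
    that the elements of G are group-like. *)
Lemma dcomulE x g1 h1 g2 h2 :
  dcomul x ((g1, h1), (g2, h2)) = (h1 == h2)%:R * x (g2 * g1, h1)%g :> k.
Proof.
rewrite /dcomul sum_ffunE.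
rewrite -[RHS](sum_kronl (g2 * g1, h1)%g (fun p => (h1 == h2)%:R * x p)).
apply: eq_bigr => -[u v] _; rewrite ffunE sum_ffunE big_mkcond /=.
rewrite (bigD1 (g2, g1)) //= big1 ?addr0 => [|[c d] ne]; last first.
  case: ifP => // _.
  rewrite tensE !dbasE !xpair_eqE -natrM mulnb.
  move: ne; rewrite xpair_eqE ![_ == c]eq_sym ![_ == d]eq_sym.
  by do 2!case: (_ == _) => //=; rewrite andbF.
rewrite !xpair_eqE [u == _]eq_sym; case: eqP => [<-|_] /=; last first.
  by rewrite [_ *: _]mulr0 mul0r.
rewrite tensE !dbasE !xpair_eqE !eqxx /= /GRing.scale /= -natrM mulnb.
rewrite [v == h1]eq_sym; case: eqP => [->|_]; last by rewrite mul0r mulr0.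
by rewrite eq_sym mul1r mulrC.
Qed.

(** The map induced by the antipode on basis indices is an involution, so coefficients are read
    through the same formula. *)
Lemma dantipodeE x g h :
  dantipode x (g, h) = x (h^-1 * g^-1 * h, h^-1)%g :> k.
Proof.
rewrite /dantipode sum_ffunE -[RHS](sum_kronl (h^-1 * g^-1 * h, h^-1)%g x).
apply: eq_bigr => -[u v] _; rewrite ffunE dbasE /GRing.scale /= mulrC.
congr (_%:R * _); rewrite !xpair_eqE [h == _]eq_sym (can2_eq invgK invgK).
case: (eqVneq v h^-1%g) => [->|]; rewrite ?andbF // !andbT invgK.
by congr nat_of_bool; apply/eqP/eqP=> ->; rewrite ?invMg ?invgK !mulgA ?(mulgV, mulVg) mul1g ?(mulgK, mulgKV).
Qed.

Lemma lfun_dbas (f : 'End(dbl)) x q : f x q = \sum_s x s * f (dbas k s) q :> k.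
Proof.
rewrite [x in LHS]dbl_sum linear_sum sum_ffunE.
by apply: eq_bigr => s _; rewrite linearZ ffunE.
Qed.

Lemma lfun_dbasP (f f' : 'End(dbl)) :
  (forall p, f (dbas k p) = f' (dbas k p)) -> f = f'.
Proof.
move=> e; apply/lfunP=> x; apply/ffunP=> q.
by rewrite !lfun_dbas; apply: eq_bigr => s _; rewrite e.
Qed.

Lemma tens_mapE (f : 'End(dbl)) (t : dbl2) q q' :
  tens_map f t (q, q') =
  \sum_s \sum_s' t (s, s') * (f (dbas k s) q * f (dbas k s') q') :> k.
Proof.
rewrite /tens_map sum_ffunE; apply: eq_bigr => s _; rewrite sum_ffunE.
by apply: eq_bigr => s' _; rewrite !ffunE.
Qed.

Section WeightedPullback.
Variables (I : finType) (c : I -> gT * gT -> k) (tau : I -> gT * gT -> gT * gT).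

(** Common shape of the automorphisms built below, both in Lambda(G) and in K: prescribing the
    coefficients of the image, rather than the images of basis vectors, makes each Hopf axiom a
    reindexing of sums. *)
Definition wpull_fun x : dbl := [ffun q => \sum_i c i q * x (tau i q)].

Lemma wpull_is_linear : linear wpull_fun.
Proof.
move=> l x y; apply/ffunP=> q; rewrite !ffunE /= scaler_sumr -big_split /=.
by apply: eq_bigr => i _; rewrite !ffunE mulrDr scalerAr.
Qed.
HB.instance Definition _ :=
  GRing.isLinear.Build k dbl dbl *:%R wpull_fun wpull_is_linear.

Definition wpull : 'End(dbl) := linfun wpull_fun.

Lemma wpullE x q : wpull x q = \sum_i c i q * x (tau i q) :> k.
Proof. by rewrite lfunE ffunE. Qed.

Lemma wpull_tens (t : dbl2) q q' : tens_map wpull t (q, q') =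
  \sum_i \sum_j c i q * c j q' * t (tau i q, tau j q') :> k.
Proof.
rewrite tens_mapE.
under eq_bigr => s _ do under eq_bigr => s' _ do
  rewrite !wpullE mulr_suml mulr_sumr.
under eq_bigr => s _ do rewrite exchange_big /=.
rewrite exchange_big; apply: eq_bigr => i _.
under eq_bigr => s _ do under eq_bigr => s' _ do rewrite !mulr_sumr.
under eq_bigr => s _ do rewrite exchange_big /=.
rewrite exchange_big; apply: eq_bigr => j _ /=.
rewrite -[RHS](sum_kronl (tau i q)
  (fun p => c i q * c j q' * t (p, tau j q'))); apply: eq_bigr => s _.
rewrite -[in RHS](sum_kronl (tau j q') (fun p => c i q * c j q' * t (s, p))).
rewrite mulr_sumr; apply: eq_bigr => s' _; rewrite !dbasE.
rewrite ![_ == s]eq_sym ![_ == s']eq_sym.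
by case: (s == _); case: (s' == _); rewrite ?(mul1r, mul0r, mulr0, mulr1) // mulrC.
Qed.

End WeightedPullback.

End Coefficients.

(** * Automorphisms built from central Hopf maps *)

Section CentralHopfMaps.
Variables (k : fieldType) (gT : finGroupType).
Implicit Types (g h s t z w : gT).
Local Notation dbl := {ffun gT * gT -> k^o}.

(* P z s is the coefficient of s in p(e_z), for a Hopf algebra map p from
   (k^G)^cop to kG that factors through the centre on both sides. *)
Record central_hopf_map (P : gT -> gT -> k) : Prop := CentralHopfMap {
  chm_unit : forall s, \sum_z P z s = (s == 1%g)%:R;
  chm_mul : forall z z' t,
    \sum_s P z s * P z' (s^-1 * t)%g = (z == z')%:R * P z t;
  chm_counit : forall z, \sum_s P z s = (z == 1%g)%:R;
  chm_comul : forall w s s',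
    \sum_z P z s * P (z^-1 * w)%g s' = (s == s')%:R * P w s;
  chm_antipode : forall z s, P z^-1%g s^-1%g = P z s;
  chm_central : forall z s, P z s != 0 ->
    (forall g, commute z g) /\ (forall g, commute s g)
}.

(** The map a # h |-> a_(1) # p(a_(2)) h: it sends e_g # h to the sum of the terms P z s times e_(g
    z^-1) # s h. *)
Definition lam (P : gT -> gT -> k) : 'End(dbl) :=
  wpull (fun (i : gT * gT) _ => P i.1 i.2)
        (fun i q => (q.1 * i.1, i.2^-1 * q.2)%g).

Lemma lamE P (x : dbl) g h :
  lam P x (g, h) = \sum_z \sum_s P z s * x (g * z, s^-1 * h)%g :> k.
Proof. by rewrite wpullE sum_pair. Qed.

Section LamHopf.
Variables (P : gT -> gT -> k) (hP : central_hopf_map P).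

(** Terms with a non-central index vanish, so under a weight [P z s] both indices may be commuted
    with anything. *)
Lemma chm_eq z s (a b : k) :
  ((forall g, commute z g) -> (forall g, commute s g) -> a = b) ->
  P z s * a = P z s * b.
Proof.
by have [->|/(chm_central hP)[cz cs] ->] := eqVneq (P z s) 0; rewrite ?mul0r.
Qed.

Lemma lam_unit : lam P (dunit k gT) = dunit k gT.
Proof.
apply/ffunP=> -[g h]; rewrite lamE dunitE -(chm_unit hP).
apply: eq_bigr => z _; rewrite -[RHS](sum_kronr h (P z)).
apply: eq_bigr => s _; rewrite dunitE; congr (_ * (nat_of_bool _)%:R).
by rewrite -(inj_eq (mulgI s)) mulKVg mulg1 eq_sym.
Qed.

Lemma lam_mul (x y : dbl) : lam P (dmul x y) = dmul (lam P x) (lam P y).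
Proof.
apply/ffunP=> -[g h]; rewrite lamE dmulE.
transitivity (\sum_z \sum_s \sum_z' \sum_s' \sum_c P z s * P z' s' *
   (x (g * z, s^-1 * c)%g * y (c^-1 * g * c * z', s'^-1 * (c^-1 * h))%g)); last first.
  symmetry; under eq_bigr => c _.
    rewrite !lamE mulr_suml; under eq_bigr => z _.
      rewrite mulr_suml; under eq_bigr => s _.
        rewrite mulr_sumr; under eq_bigr => z' _.
          rewrite mulr_sumr; under eq_bigr => s' _ do rewrite mulrACA.
          over.
        over.
      over.
    over.
  rewrite /= exchange_big; apply: eq_bigr => z _.
  rewrite exchange_big; apply: eq_bigr => s _.
  rewrite exchange_big; apply: eq_bigr => z' _.
  by rewrite exchange_big.
apply: eq_bigr => z _; symmetry.
(* Replacing [s'] by [s^-1 s'] and [c] by [s c] leaves [s] only in the two weights, so that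
   [chm_mul] can collapse the sum over [s] and force [z = z']. *)
transitivity (\sum_s \sum_z' \sum_s' P z s * P z' (s^-1 * s')%g *
   \sum_c x (g * z, c)%g * y (c^-1 * (g * z') * c, c^-1 * (s'^-1 * h))%g).
  apply: eq_bigr => s _; apply: eq_bigr => z' _; rewrite (reindex_inj (mulgI s^-1%g)) /=.
  apply: eq_bigr => s' _; rewrite mulr_sumr (reindex_inj (mulgI s)) /=.
  apply: eq_bigr => c _; rewrite -!mulrA; apply: chm_eq => _ cs.
  apply: chm_eq => cz' cs'; rewrite mulKg; congr (_ * y (_, _)).
    rewrite invMg -!mulgA; congr (_ * _)%g.
    by rewrite (mulgA g) -(cs g) -!mulgA mulKg (cz' c).
  rewrite !mulgA; congr (_ * _)%g; rewrite -!invMg; congr (_^-1)%g.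
  by rewrite -cs' mulgA cs' mulKVg.
transitivity (\sum_z' \sum_s' (z == z')%:R * P z s' *
   \sum_c x (g * z, c)%g * y (c^-1 * (g * z') * c, c^-1 * (s'^-1 * h))%g).
  rewrite exchange_big; apply: eq_bigr => z' _ /=.
  rewrite exchange_big; apply: eq_bigr => s' _ /=.
  by rewrite -[LHS]mulr_suml (chm_mul hP).
rewrite exchange_big; apply: eq_bigr => s _ /=.
under eq_bigr => z' _ do rewrite -mulrA eq_sym.
by rewrite sum_kronl; congr (_ * _); rewrite dmulE.
Qed.

Lemma lam_counit (x : dbl) : dcounit (lam P x) = dcounit x.
Proof.
rewrite !dcounitE; under eq_bigr => h _ do rewrite lamE.
rewrite exchange_big /=.
transitivity (\sum_z \sum_s P z s * \sum_h x (z, h)).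
  apply: eq_bigr => z _; rewrite exchange_big; apply: eq_bigr => s _ /=.
  rewrite -mulr_sumr; congr (_ * _); rewrite [RHS](reindex_inj (mulgI s^-1%g)).
  by apply: eq_bigr => h _; rewrite mul1g.
rewrite -[RHS](sum_kronl 1%g (fun z => \sum_h x (z, h))).
by apply: eq_bigr => z _; rewrite -[LHS]mulr_suml (chm_counit hP).
Qed.

Lemma lam_comul (x : dbl) : dcomul (lam P x) = tens_map (lam P) (dcomul x).
Proof.
apply/ffunP=> -[[g1 h1] [g2 h2]]; rewrite dcomulE wpull_tens sum_pair lamE.
under [RHS]eq_bigr => z _ do under eq_bigr => s _ do rewrite sum_pair /=.
transitivity (\sum_s \sum_w (h1 == h2)%:R * (P w s * x (g2 * g1 * w, s^-1 * h1)%g)).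
  by rewrite exchange_big mulr_sumr; apply: eq_bigr => s _; rewrite mulr_sumr.
rewrite [RHS]exchange_big; apply: eq_bigr => s _ /=.
transitivity (\sum_z \sum_w \sum_s' P z s * P (z^-1 * w)%g s' *
   ((s^-1 * h1 == s'^-1 * h2)%g%:R * x (g2 * g1 * w, s^-1 * h1)%g)); last first.
  apply: eq_bigr => z _; rewrite [RHS](reindex_inj (mulgI z^-1%g)) /=.
  apply: eq_bigr => w _; apply: eq_bigr => s' _; rewrite dcomulE -!mulrA.
  apply: chm_eq => cz _; apply: chm_eq => cw _; congr (_ * x (_, _)).
  by rewrite -!mulgA; congr (_ * _)%g; rewrite [RHS]mulgA cw -mulgA mulKVg.
rewrite exchange_big; apply: eq_bigr => w _ /=.
rewrite exchange_big /=.
transitivity (\sum_s' (s' == s)%:R * (P w s *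
    ((s^-1 * h1 == s'^-1 * h2)%g%:R * x (g2 * g1 * w, s^-1 * h1)%g))).
  by rewrite sum_kronl (inj_eq (mulgI _)) mulrCA.
by apply: eq_bigr => s' _; rewrite -[RHS]mulr_suml (chm_comul hP) -mulrA eq_sym.
Qed.

Lemma lam_antipode (x : dbl) : dantipode (lam P x) = lam P (dantipode x).
Proof.
apply/ffunP=> -[g h]; rewrite dantipodeE !lamE [RHS](reindex_inj invg_inj).
apply: eq_bigr => z _; rewrite [RHS](reindex_inj invg_inj).
apply: eq_bigr => s _; rewrite (chm_antipode hP); apply: chm_eq => cz cs.
rewrite dantipodeE; congr (x (_, _)).
  rewrite !(invMg, invgK) -!mulgA; congr (_ * _)%g.
  by rewrite (cs h) (cz (_ * (h * s)))%g (mulgA _ h s) -(cs (_ * h))%g -!mulgA mulKg.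
by rewrite invgK -invMg cs.
Qed.

(** Comultiplicativity of p as a contraction rule: two copies of p joined along the product [z * z']
    merge into one, with equal group labels. *)
Lemma chm_convolve (F : gT -> gT -> gT -> k) :
  \sum_z \sum_s \sum_z' \sum_s' P z s * P z' s' * F (z * z')%g s s' =
  \sum_w \sum_s P w s * F w s s.
Proof.
rewrite exchange_big [RHS]exchange_big; apply: eq_bigr => s _ /=.
transitivity (\sum_w \sum_s' \sum_z P z s * P (z^-1 * w)%g s' * F w s s').
  under [RHS]eq_bigr => w _ do rewrite exchange_big.
  rewrite [RHS]exchange_big; apply: eq_bigr => z _ /=.
  rewrite (reindex_inj (mulgI z^-1%g)); apply: eq_bigr => w _ /=.
  by apply: eq_bigr => s' _; rewrite mulKVg.
apply: eq_bigr => w _; rewrite -(sum_kronl s (fun s' => P w s * F w s s')).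
by apply: eq_bigr => s' _; rewrite -[LHS]mulr_suml (chm_comul hP) -mulrA eq_sym.
Qed.

Lemma chm_counit_sum (F : gT -> k) : \sum_w \sum_s P w s * F w = F 1%g.
Proof.
rewrite -[RHS](sum_kronl 1%g F).
by apply: eq_bigr => w _; rewrite -[LHS]mulr_suml (chm_counit hP).
Qed.

(** The inverse comes from the convolution inverse of p, namely p followed by the antipode of kG. *)
Lemma lam_bij : bijective (lam P).
Proof.
have lamVE (x : dbl) g h : lam (fun z s => P z s^-1%g) x (g, h) =
    \sum_z \sum_s P z s * x (g * z, s * h)%g :> k.
  rewrite lamE; apply: eq_bigr => z _; rewrite (reindex_inj invg_inj).
  by apply: eq_bigr => s _; rewrite invgK.
exists (lam (fun z s => P z s^-1%g)) => x; apply/ffunP=> -[g h].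
  rewrite lamVE -[g in RHS]mulg1 -[RHS](chm_counit_sum (fun w => x (g * w, h)%g)).
  transitivity (\sum_w \sum_s P w s * x (g * w, s^-1 * (s * h))%g); last first.
    by apply: eq_bigr => w _; apply: eq_bigr => s _; rewrite mulKg.
  rewrite -(chm_convolve (fun w s s' => x (g * w, s'^-1 * (s * h))%g)).
  apply: eq_bigr => z _; apply: eq_bigr => s _; rewrite lamE mulr_sumr.
  apply: eq_bigr => z' _; rewrite mulr_sumr; apply: eq_bigr => s' _.
  by rewrite mulrA (mulgA g).
rewrite lamE -[g in RHS]mulg1 -[RHS](chm_counit_sum (fun w => x (g * w, h)%g)).
transitivity (\sum_w \sum_s P w s * x (g * w, s * (s^-1 * h))%g); last first.
  by apply: eq_bigr => w _; apply: eq_bigr => s _; rewrite mulKVg.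
rewrite -(chm_convolve (fun w s s' => x (g * w, s' * (s^-1 * h))%g)).
apply: eq_bigr => z _; apply: eq_bigr => s _; rewrite lamVE mulr_sumr.
apply: eq_bigr => z' _; rewrite mulr_sumr; apply: eq_bigr => s' _.
by rewrite mulrA (mulgA g).
Qed.

Lemma hopf_aut_lam : hopf_aut (lam P).
Proof.
split; last exact: lam_bij.
by split; [exact: lam_unit | exact: lam_mul | exact: lam_counit
          | exact: lam_comul | exact: lam_antipode].
Qed.

End LamHopf.
End CentralHopfMaps.

(** * Automorphisms given by a bicharacter and two permutations *)

Section TwistedPullbacks.
Variables (k : fieldType) (gT : finGroupType).
Implicit Types (g h s t z w : gT).
Local Notation dbl := {ffun gT * gT -> k^o}.
Variables (rho : gT -> gT -> k) (al be : {perm gT}).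
Hypothesis rho0 : forall h g, rho h g != 0.
Hypothesis rhoMl : forall h h' g, rho (h * h')%g g = rho h g * rho h' g.
Hypothesis rhoMr : forall h g g', rho h (g * g')%g = rho h g * rho h g'.
Hypothesis alM : {morph al : g h / (g * h)%g}.
Hypothesis beM : {morph be : g h / (g * h)%g}.
Hypothesis alJ : forall g h, (al (h^-1 * g * h) = (be h)^-1 * al g * be h)%g.

Definition twist : 'End(dbl) :=
  wpull (fun (_ : unit) q => rho q.2 q.1) (fun _ q => (al q.1, be q.2)).

Lemma twistE (x : dbl) g h : twist x (g, h) = rho h g * x (al g, be h) :> k.
Proof. by rewrite wpullE (big_pred1 tt) // => -[]. Qed.

Lemma twist_tens (T : {ffun (gT * gT) * (gT * gT) -> k^o}) g h g' h' : tens_map twist T ((g, h), (g', h')) =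
  rho h g * rho h' g' * T ((al g, be h), (al g', be h')) :> k.
Proof. by rewrite wpull_tens (big_pred1 tt) => [|[]] //; rewrite (big_pred1 tt) => [|[]]. Qed.

Let rho1l g : rho 1%g g = 1.
Proof. by apply: (mulfI (rho0 1%g g)); rewrite -rhoMl mulg1 mulr1. Qed.
Let rho1r h : rho h 1%g = 1.
Proof. by apply: (mulfI (rho0 h 1%g)); rewrite -rhoMr mulg1 mulr1. Qed.
Let al1 : al 1%g = 1%g.
Proof. by apply: (mulgI (al 1%g)); rewrite -alM !mulg1. Qed.
Let be1 : be 1%g = 1%g.
Proof. by apply: (mulgI (be 1%g)); rewrite -beM !mulg1. Qed.
Let alV g : (al g^-1 = (al g)^-1)%g.
Proof. by apply: (mulgI (al g)); rewrite -alM !mulgV. Qed.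
Let beV g : (be g^-1 = (be g)^-1)%g.
Proof. by apply: (mulgI (be g)); rewrite -beM !mulgV. Qed.
Let rhoV h g : rho h^-1%g g^-1%g = rho h g.
Proof.
apply: (mulfI (rho0 h^-1%g g)); rewrite -rhoMr -rhoMl mulgV mulVg.
by rewrite rho1l rho1r.
Qed.
Let rhoJ h g c : rho h (c^-1 * g * c)%g = rho h g.
Proof. by rewrite !rhoMr mulrAC -rhoMr mulVg rho1r mul1r. Qed.

Lemma hopf_aut_twist : hopf_aut twist.
Proof.
split.
  split=> [|x y|x|x|x]; try apply/ffunP=> -[g h].
  - rewrite twistE !dunitE -{1}be1 (inj_eq perm_inj).
    by case: eqP => [->|]; rewrite ?rho1l ?mulr1 // mulr0.
  - rewrite twistE !dmulE mulr_sumr (reindex_inj (@perm_inj _ be)) /=.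
    apply: eq_bigr => c _; rewrite !twistE rhoJ alJ beM beV mulrACA -rhoMl.
    by rewrite mulKVg.
  - rewrite !dcounitE [RHS](reindex_inj (@perm_inj _ be)).
    by apply: eq_bigr => h _; rewrite twistE rho1r mul1r al1.
  - case: g h => [g1 h1] [g2 h2].
    rewrite dcomulE twist_tens dcomulE twistE (inj_eq perm_inj) alM rhoMr.
    by case: eqP => [->|_]; rewrite ?mul0r ?mulr0 // !mul1r (mulrC (rho _ g2)).
  rewrite dantipodeE !twistE dantipodeE rhoJ rhoV; by rewrite alJ alV beV.
pose inv (x : dbl) : dbl := [ffun q => (rho (be^-1%g q.2) (al^-1%g q.1))^-1 *
                                (x (al^-1%g q.1, be^-1%g q.2) : k)].
exists inv => x.
  by apply/ffunP=> -[g h]; rewrite ffunE twistE /= !permKV mulKf.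
by apply/ffunP=> -[g h]; rewrite twistE ffunE /= !permK mulVKf.
Qed.

End TwistedPullbacks.

(** * Fitting's argument for central endomorphisms *)

Section CentralEndomorphisms.
Variable gT : finGroupType.

(* An iterate of z that is idempotent splits the group as the direct product of
   its image, which is central, and its kernel. *)
Lemma central_endo_fix (z : gT -> gT) : purely_nonabelian gT ->
  {morph z : x y / (x * y)%g} -> (forall x y, commute (z x) y) ->
  forall x, z x = x -> x = 1%g.
Proof.
move=> pna zM zC x zx.
have itM n : {morph iter n z : x y / (x * y)%g}.
  by elim: n => // n IHn u v; rewrite /= IHn zM.
have [m m0 idem] : exists2 m, (0 < m)%N &
    forall u, iter m z (iter m z u) = iter m z u.
  pose F (i : 'I_#|{ffun gT -> gT}|.+1) : {ffun gT -> gT} := [ffun u => iter i z u].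
  have [i [j [ij eF]]] : exists i j : 'I__, (i < j)%N /\ F i = F j.
    have /injectivePn[i [j ij eF]] : ~~ injectiveb F.
      by apply/injectiveP => /leq_card; rewrite card_ord ltnn.
    have [lt|lt|/val_inj e] := ltngtP i j; [by exists i, j | by exists j, i |].
    by rewrite e eqxx in ij.
  have per n u : iter (n * (j - i) + i) z u = iter i z u.
    elim: n => // n IHn; rewrite mulSn -addnA iterD IHn -iterD subnK 1?ltnW //.
    by have := congr1 (fun f : {ffun gT -> gT} => f u) eF; rewrite /F !ffunE.
  (* The exponent must be a multiple of the period [j - i] and at least the preperiod [i]; the
     factor [i.+1] also keeps it positive when [i = 0]. *)
  exists (i.+1 * (j - i))%N => [|u]; first by rewrite muln_gt0 subn_gt0.
  have le : (i <= i.+1 * (j - i))%N.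
    by apply: leq_trans (leqnSn i) _; rewrite leq_pmulr ?subn_gt0.
  by rewrite -iterD -[in LHS](subnKC le) addnA [in LHS]addnC iterD subnKC // per -iterD subnK.
pose e := Morphism (D := [set: gT]%SET) (in2W (itM m)).
(* Positivity of [m] matters here: the image of a positive iterate lies in the image of [z], hence
   in the centre. *)
have eC u v : commute (e u) v by rewrite /e /= -(prednK m0) iterS; apply: zC.
have xe : x \in (e @* [set: gT]%SET)%g.
  apply/morphimP; exists x; rewrite ?inE //= /e /=.
  by elim: (m) => //= n <-.
have AC : (e @* [set: gT]%SET \subset 'C([set: gT]))%g.
  by apply/fintype.subsetP=> _ /morphimP[u _ _ ->]; apply/centP => v _; apply: eC.
have AB : (e @* [set: gT]%SET \x 'ker e = [set: gT])%g.
  rewrite dprodE.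
  - apply/finset.setP => u; rewrite inE; apply/mulsgP.
    exists (e u) ((e u)^-1 * u)%g; [by rewrite mem_morphim ?inE | | by rewrite mulKVg].
    apply/kerP; rewrite ?inE // morphM ?inE // morphV ?inE //=.
    by rewrite /e /= idem mulVg.
  - by rewrite centsC (fintype.subset_trans AC) // centS ?finset.subsetT.
  apply/trivgP/fintype.subsetP=> _ /finset.setIP[/morphimP[u _ _ ->] /mker /=].
  by rewrite idem => ->; rewrite inE.
have /(pna _ _ AB) A1 : abelian (e @* [set: gT]%SET)%g.
  by rewrite /abelian (fintype.subset_trans AC) // centS ?finset.subsetT.
by move: xe; rewrite A1 => /finset.set1P.
Qed.

End CentralEndomorphisms.

(** * Nondegenerate symmetric pairings on finite abelian groups *)

Section Pairing.
Variable k : closedFieldType.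
Hypothesis char0 : [pchar k] =i pred0.

Lemma prim_root_exists n : (0 < n)%N -> exists z : k, n.-primitive_root z.
Proof.
move=> n_gt0; pose p : {poly k} := 'X^n - 1.
have [r Dp] := closed_field_poly_normal p.
rewrite (monicP _) ?monicXnsubC // scale1r in Dp.
have rn1 : all n.-unity_root r by apply/allP=> z; rewrite -root_prod_XsubC -Dp.
have sz_r : (n < (size r).+1)%N by rewrite -(size_prod_XsubC r id) -Dp size_XnsubC.
have ur : uniq r.
  rewrite -separable_prod_XsubC -Dp separable_Xn_sub_1 //.
  by rewrite (iffLR (pcharf0P k) char0) -lt0n.
by have /hasP[z _] := has_prim_root n_gt0 rn1 ur sz_r; exists z.
Qed.

(** On a cyclic factor generated by [x], pair [x ^+ i] with [x ^+ j] to [zt ^+ (i * j)], where [zt]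
    is a primitive root of unity of order [#[x]], and multiply over the factors. Non-vanishing and
    symmetry are stated on the whole type, so that they can be used without membership
    conditions. *)
Lemma abelian_pairing (gT : finGroupType) (G : {group gT}) : abelian G ->
  exists2 b : gT -> gT -> k,
    (forall x y, b x y != 0) /\ (forall x y, b x y = b y x) &
    {in G & &, forall x y z, b (x * y)%g z = b x z * b y z} /\
    {in G, forall x, {in G, forall y, b x y = 1} -> x = 1%g}.
Proof.
case/abelian_structure=> bs /= + _; elim: bs => [|x bs IH] /= in G *.
  rewrite big_nil => G1; exists (fun _ _ => 1).
    by split=> *; rewrite ?oner_eq0.
  split=> [x y z _ _ _|x]; first by rewrite mulr1.
  by rewrite -G1 => /set1gP.
rewrite big_cons => /dprodP[[K H defK defH] KH cKH tiKH].
rewrite defK defH in KH cKH tiKH.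
have [b [b0 bC] [bM bN]] := IH H defH.
have [zt ztP] := prim_root_exists (order_gt0 x).
(* A discrete logarithm to the base [x]. It is determined only modulo the order of [x], so
   multiplicativity is stated for powers of [zt]. *)
pose dl y := xget 0%N [set i | y = x ^+ i]%g%classic.
have dlK y : y \in K -> (x ^+ dl y = y)%g.
  rewrite -defK => /cycleP[i e]; symmetry; apply: (@xgetPex _ 0%N [set i | y = x ^+ i]%g%classic).
  by exists i.
have ztE n m : (x ^+ n = x ^+ m)%g -> zt ^+ n = zt ^+ m.
  by move/eqP; rewrite eq_expg_mod_order -(eq_prim_root_expr ztP) => /eqP.
have zt0 n : zt ^+ n != 0.
  apply: expf_neq0; apply: contra_eq_neq (prim_expr_order ztP) => ->.
  by rewrite expr0n -[_ == 0%N]negbK -lt0n order_gt0 eq_sym oner_eq0.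
have dlM u v : u \in K -> v \in K -> zt ^+ dl (u * v)%g = zt ^+ dl u * zt ^+ dl v.
  by move=> uK vK; rewrite -exprD; apply: ztE; rewrite expgD !dlK ?groupM.
have dl1 : zt ^+ dl 1%g = 1 by rewrite (@ztE _ 0%N) ?dlK ?group1.
have xK : x \in K by rewrite -defK cycle_id.
have dlx : zt ^+ dl x = zt by rewrite (@ztE _ 1%N) ?dlK.
have GKH u : u \in G -> u \in (K * H)%g by rewrite KH.
have HG u : u \in H -> u \in G by rewrite -KH; apply/fintype.subsetP/mulG_subr.
have KG u : u \in K -> u \in G by rewrite -KH; apply/fintype.subsetP/mulG_subl.
have b11 : b 1%g 1%g = 1.
  by apply: (mulfI (b0 1%g 1%g)); rewrite -bM ?group1 // mulg1 mulr1.
pose d u := divgr K H u; pose r u := remgr K H u.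
have dK u : u \in G -> d u \in K by move/GKH/mem_divgr.
have rH u : u \in G -> r u \in H by move/GKH/mem_remgr.
have cpl : (H \in [complements to K in G])%g by apply/complP.
have nKG : (K <| G)%g.
  rewrite /normal -KH mulG_subl mulG_subG normG cents_norm //.
pose be u v := zt ^+ (dl (d u) * dl (d v)) * b (r u) (r v).
exists be.
  by split=> u v; rewrite /be ?mulf_neq0 // mulnC bC.
split=> [u v w uG vG wG|u uG uN].
  rewrite /be /d /r (divgrM cpl) // (remgrM cpl) // bM ?rH //.
  by rewrite !exprM dlM ?dK // exprMn mulrACA.
(* Pairing [u] with elements of [H] sees only its [H]-part; once that is trivial, pairing with the
   generator [x] detects the cyclic part. *)
have r1 : r u = 1%g.
  apply: bN => [|v vH]; first exact: rH.
  have := uN v (HG v vH); rewrite /be /d /r -{1 2}[v]mul1g (divgrMid tiKH) ?(remgrMid tiKH) //.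
  by rewrite mulnC exprM dl1 expr1n mul1r.
have d1 : d u = 1%g.
  have := uN x (KG x xK); rewrite /be /d /r -{1 2}[x]mulg1 (divgrMid tiKH) ?(remgrMid tiKH) //.
  rewrite -/(r u) r1 b11 mulr1 mulnC exprM dlx -/(d u) => /eqP.
  rewrite -(prim_order_dvd ztP) order_dvdn => /eqP <-.
  by rewrite dlK ?dK.
by rewrite (divgr_eq K H u) -/(d u) -/(r u) d1 r1 mulg1.
Qed.

End Pairing.

(** The bridge from Hopf identities to group elements. It identifies the group-likes of the double,
    the self-maps of G dual to r p' and to [u], and the endomorphism behind a central Hopf map. *)
Lemma idempotent_family (k : fieldType) (I : finType) (E : I -> k) :
  \sum_s E s = 1 -> (forall s t, E s * E t = (s == t)%:R * E s) ->
  exists s0, forall s, E s = (s == s0)%:R.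
Proof.
move=> E1 EE; have [s0 s0n0] : exists s0, E s0 != 0.
  apply/existsP; apply: contraT => /existsPn E0; move: E1.
  rewrite big1 => [/esym/eqP|s _]; first by rewrite oner_eq0.
  by apply/eqP/negPn.
exists s0 => s; have [->|ne] := eqVneq s s0.
  by apply: (mulfI s0n0); rewrite EE eqxx mul1r mulr1.
by apply: (mulfI s0n0); rewrite EE eq_sym (negPf ne) mul0r mulr0.
Qed.

(** * Fourier transform between endomorphisms of the centre and central Hopf maps *)

Section Fourier.
Variables (k : fieldType) (gT : finGroupType).
Implicit Types (g h s t z w y : gT).
Local Notation Z := ('Z([set: gT]%SET))%g.
Variable b : gT -> gT -> k.
Hypothesis b0 : forall x y, b x y != 0.
Hypothesis bC : forall x y, b x y = b y x.
Hypothesis bM : {in Z & &, forall x y z, b (x * y)%g z = b x z * b y z}.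
Hypothesis bN : {in Z, forall x, {in Z, forall y, b x y = 1} -> x = 1%g}.
Hypothesis cardZ : #|Z|%:R != 0 :> k.

Lemma centerTP z : reflect (forall g, commute z g) (z \in Z).
Proof.
apply: (iffP idP) => [/finset.setIP[_ /centP zC] g|zC]; first by apply: zC; rewrite inE.
by apply/finset.setIP; split; rewrite ?inE //; apply/centP => g _.
Qed.

Let bMr x y z : x \in Z -> y \in Z -> z \in Z -> b x (y * z)%g = b x y * b x z.
Proof. by move=> *; rewrite bC bM // ![b _ x]bC. Qed.

Let b1l y : y \in Z -> b 1%g y = 1.
Proof. by move=> yZ; apply: (mulfI (b0 1%g y)); rewrite -bM ?group1 // mulg1 mulr1. Qed.

Let bV x y : x \in Z -> y \in Z -> b x^-1%g y = b x y^-1%g.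
Proof.
move=> xZ yZ; apply: (mulfI (b0 x y)).
by rewrite -bM ?groupV // -bMr ?groupV // !mulgV [in RHS]bC !b1l.
Qed.

Lemma pairing_sum x : x \in Z -> \sum_(y in Z) b x y = #|Z|%:R * (x == 1%g)%:R.
Proof.
move=> xZ; case: eqP => [->|x1].
  rewrite mulr1 (eq_bigr (fun=> 1)) => [|y yZ]; last exact: b1l.
  by rewrite sumr_const.
rewrite mulr0; have [y yZ by1] : exists2 y, y \in Z & b x y != 1.
  apply/exists_inP; apply: contra_notT x1 => /exists_inPn h.
  by apply: bN => // y /h /negPn/eqP.
(* Translating the summation index by [y] multiplies the sum by [b x y], which differs from 1. *)
apply: (mulfI (_ : b x y - 1 != 0)); first by rewrite subr_eq0.
rewrite mulr0 mulrBl mul1r [X in _ - X](reindex_inj (mulgI y)) mulr_sumr.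
apply/eqP; rewrite subr_eq0; apply/eqP.
rewrite [RHS](eq_bigl [in Z]) => [|z]; last by rewrite groupMl.
by apply: eq_bigr => z zZ; rewrite bMr.
Qed.

Lemma pairing_suml x : x \in Z -> \sum_(y in Z) b y x = #|Z|%:R * (x == 1%g)%:R.
Proof. by move=> xZ; rewrite -pairing_sum //; apply: eq_bigr => y _; rewrite bC. Qed.

(* The Hopf map sending the character b y of Z to F y. *)
Definition fourier (F : gT -> gT) z s : k :=
  (z \in Z)%:R * (#|Z|%:R^-1 * \sum_(y in Z) b y z * (F y == s^-1)%g%:R).

Lemma fourierE F z s : z \in Z ->
  fourier F z s = #|Z|%:R^-1 * \sum_(y in Z) b y z * (F y == s^-1)%g%:R.
Proof. by rewrite /fourier => ->; rewrite mul1r. Qed.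

(** Fourier inversion, for the character [b y^-1]. The inverse on [s] arises because [fourier] uses
    [b y z] where the expansion of e_z in characters has its inverse: the summation variable there
    is [y^-1]. *)
Lemma fourier_inv F y s : y \in Z ->
  \sum_(z in Z) b y z^-1%g * fourier F z s = (F y == s^-1)%g%:R.
Proof.
move=> yZ; under eq_bigr => z zZ do rewrite fourierE // mulrCA mulr_sumr.
rewrite -mulr_sumr exchange_big /=; apply: (mulfI cardZ); rewrite mulVKf //.
rewrite (bigD1 y) //= [X in _ + X]big1 ?addr0 => [|x /andP[xZ xy]].
  under eq_bigr => z zZ do rewrite mulrA -bV // -bM ?groupV // mulVg b1l // mul1r.
  by rewrite sumr_const mulr_natl.
under eq_bigr => z zZ do rewrite mulrA -bV // -bM ?groupV //.
rewrite -mulr_suml pairing_sum ?groupM ?groupV //.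
by rewrite -eq_mulVg1 eq_sym (negPf xy) mulr0 mul0r.
Qed.

Lemma fourier_inj F F' : (forall z s, fourier F z s = fourier F' z s) ->
  {in Z, F =1 F'}.
Proof.
move=> e y yZ; have := fourier_inv F (F y)^-1%g yZ.
under eq_bigr => z _ do rewrite e; rewrite fourier_inv // invgK eqxx.
by case: eqP => // _ /esym/eqP; rewrite oner_eq0.
Qed.

Section FourierHopf.
Variable F : gT -> gT.
Hypothesis FM : {in Z &, {morph F : x y / (x * y)%g}}.
Hypothesis FZ : forall y, y \in Z -> F y \in Z.

Let F1 : F 1%g = 1%g.
Proof. by apply: (mulgI (F 1%g)); rewrite -FM ?group1 // !mulg1. Qed.

Lemma fourier_unit s : \sum_z fourier F z s = (s == 1%g)%:R.
Proof.
transitivity (\sum_(z in Z) fourier F z s).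
  by rewrite [RHS]big_mkcond; apply: eq_bigr => z _; rewrite /fourier; case: (z \in Z); rewrite ?mul0r.
under eq_bigr => z zZ do rewrite fourierE //.
rewrite -mulr_sumr exchange_big /=; apply: (mulfI cardZ); rewrite mulVKf //.
rewrite (bigD1 1%g) //= [X in _ + X]big1 ?addr0 => [|x /andP[xZ x1]].
  by rewrite -mulr_suml pairing_sum // eqxx mulr1 F1 -eq_invg1 eq_sym.
by rewrite -mulr_suml pairing_sum // (negPf x1) mulr0 mul0r.
Qed.

Lemma fourier_counit z : \sum_s fourier F z s = (z == 1%g)%:R.
Proof.
have [zZ|zZ] := boolP (z \in Z); last first.
  rewrite big1 => [|s _]; last by rewrite /fourier (negPf zZ) mul0r.
  by case: eqP zZ => // ->; rewrite group1.
under eq_bigr => s _ do rewrite fourierE //.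
rewrite -mulr_sumr exchange_big /=; apply: (mulfI cardZ); rewrite mulVKf //.
rewrite -pairing_suml //; apply: eq_bigr => y _.
rewrite -mulr_sumr -[RHS]mulr1; congr (_ * _).
rewrite -[RHS](sum_kron k (F y)^-1%g); apply: eq_bigr => s _.
by rewrite -[in RHS](inj_eq invg_inj) invgK eq_sym.
Qed.

Lemma fourier_mul z z' t : \sum_s fourier F z s * fourier F z' (s^-1 * t)%g =
  (z == z')%:R * fourier F z t.
Proof.
have [zZ|zZ] := boolP (z \in Z); last first.
  rewrite big1 => [|s _]; first by rewrite /fourier (negPf zZ) mul0r mulr0.
  by rewrite {1}/fourier (negPf zZ) !mul0r.
have [zZ'|zZ'] := boolP (z' \in Z); last first.
  rewrite big1 => [|s _]; last by rewrite /fourier (negPf zZ') mul0r mulr0.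
  by case: eqP zZ' => [<-|]; rewrite ?zZ // mul0r.
transitivity (#|Z|%:R^-1 * (#|Z|%:R^-1 * \sum_(y in Z) \sum_(y' in Z)
    b y z * b y' z' * (F (y * y') == t^-1)%g%:R)).
  under eq_bigr => s _ do rewrite !fourierE // mulrACA -mulrA big_distrlr /=.
  rewrite -mulr_sumr -mulr_sumr; congr (_ * (_ * _)).
  rewrite exchange_big; apply: eq_bigr => y yZ.
  rewrite exchange_big; apply: eq_bigr => y' yZ' /=.
  rewrite -[RHS](sum_kronl (F y)^-1%g (fun s => b y z * b y' z' * (F (y * y') == t^-1)%g%:R)).
  apply: eq_bigr => s _; rewrite mulrACA [RHS]mulrCA; congr (_ * _).
  have -> : (s == (F y)^-1)%g = (F y == s^-1)%g.
    by rewrite -[LHS](inj_eq invg_inj) invgK eq_sym.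
  case: eqP => [e|_]; rewrite ?mul0r ?mul1r // FM // e invMg invgK.
  have /centerTP zC := FZ yZ'.
  by rewrite -zC -[in LHS](inj_eq (mulIg s^-1%g)) mulgK.
(* Replacing [y'] by [y^-1 y'] separates the variables: what remains of [y] is a character sum at
   [z * z'^-1], equal to |Z| if [z = z'] and to 0 otherwise. *)
transitivity (#|Z|%:R^-1 * (#|Z|%:R^-1 * \sum_(y in Z) \sum_(y' in Z)
    b y' z' * (F y' == t^-1)%g%:R * b y (z * z'^-1)%g)).
  congr (_ * (_ * _)); apply: eq_bigr => y yZ.
  rewrite (reindex_inj (mulgI y^-1%g)) [LHS](eq_bigl [in Z]) /= => [|y']; last first.
    by rewrite groupMl ?groupV.
  apply: eq_bigr => y' yZ'; rewrite mulKVg bM ?groupV // bMr ?groupV // bV //.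
  by rewrite [RHS]mulrC -!mulrA.
rewrite exchange_big /=.
under eq_bigr => y' yZ' do rewrite -mulr_sumr pairing_suml ?groupM ?groupV //.
rewrite -mulr_suml -eq_mulgV1 fourierE //.
case: eqP => [<-|_]; last by rewrite !mulr0 mul0r.
by rewrite mulr1 mul1r; congr (_ * _); rewrite mulrC mulfK.
Qed.

Lemma fourier_comul w s s' :
  \sum_z fourier F z s * fourier F (z^-1 * w)%g s' = (s == s')%:R * fourier F w s.
Proof.
have [wZ|wZ] := boolP (w \in Z); last first.
  rewrite [in RHS]/fourier (negPf wZ) mul0r mulr0 big1 // => z _.
  rewrite /fourier; case: (boolP (z \in Z)) => zZ; last by rewrite !mul0r.
  by rewrite groupMl ?groupV // (negPf wZ) mul0r mulr0.
transitivity (\sum_(z in Z) fourier F z s * fourier F (z^-1 * w)%g s').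
  rewrite [RHS]big_mkcond; apply: eq_bigr => z _.
  by rewrite /fourier; case: (z \in Z); rewrite ?mul0r.
(* Here orthogonality is applied to the sum over [z], and forces [y = y']. *)
transitivity (#|Z|%:R^-1 * (#|Z|%:R^-1 * \sum_(y in Z) \sum_(y' in Z)
    (F y == s^-1)%g%:R * (F y' == s'^-1)%g%:R * b y' w *
    \sum_(z in Z) b (y * y'^-1)%g z)).
  under eq_bigr => z zZ.
    rewrite !fourierE ?groupM ?groupV // mulrACA -mulrA big_distrlr /=.
    over.
  rewrite -mulr_sumr -mulr_sumr; congr (_ * (_ * _)).
  rewrite exchange_big; apply: eq_bigr => y yZ.
  rewrite exchange_big; apply: eq_bigr => y' yZ' /=.
  rewrite mulr_sumr; apply: eq_bigr => z zZ.
  rewrite bMr ?groupV // bM ?groupV // bV // mulrACA [RHS]mulrC -!mulrA.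
  by congr (_ * (_ * _)); rewrite mulrC -mulrA.
under eq_bigr => y yZ.
  under eq_bigr => y' yZ' do rewrite pairing_sum ?groupM ?groupV // -eq_mulgV1.
  rewrite (bigD1 y) //= eqxx mulr1 [X in _ + X]big1 ?addr0 => [|y' /andP[_ ne]]; last first.
    by rewrite [y == y']eq_sym (negPf ne) !mulr0.
  over.
rewrite -mulr_suml fourierE // [_ * #|Z|%:R]mulrC mulKf // mulrCA; congr (_ * _).
rewrite mulr_sumr; apply: eq_bigr => y yZ.
have [->|_] := eqVneq (F y) s^-1%g; last by rewrite !(mul0r, mulr0).
by rewrite mul1r mulr1 (inj_eq invg_inj).
Qed.

Lemma fourier_antipode z s : fourier F z^-1%g s^-1%g = fourier F z s.
Proof.
rewrite /fourier groupV; case: (boolP (z \in Z)) => zZ; last by rewrite !mul0r.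
congr (_ * (_ * _)); rewrite (reindex_inj invg_inj) /=.
rewrite [LHS](eq_bigl [in Z]) => [|y]; last by rewrite groupV.
apply: eq_bigr => y yZ; rewrite bV ?groupV // invgK invgK; congr (_ * (nat_of_bool _)%:R).
have -> : F y^-1%g = (F y)^-1%g by apply: (mulgI (F y)); rewrite -FM ?groupV // !mulgV F1.
by rewrite -[in RHS](inj_eq invg_inj) !invgK.
Qed.

Lemma fourier_hopf : central_hopf_map (fourier F).
Proof.
split; [exact: fourier_unit | exact: fourier_mul | exact: fourier_counit
       | exact: fourier_comul | exact: fourier_antipode |].
move=> z s; rewrite /fourier; have [zZ|] := boolP (z \in Z); last by rewrite mul0r eqxx.
move=> nz; split; first exact/centerTP.
apply/centerTP; rewrite -groupV; apply: contraNT nz => sZ.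
rewrite big1 ?mulr0 // => y yZ; case: eqP (FZ yZ) => [->|_]; last by rewrite mulr0.
by rewrite (negPf sZ).
Qed.

End FourierHopf.

(** A Hopf map sends the characters of Z to group-likes of kG, that is, to group elements. [E y]
    lists the coefficients of the image of the character [b y^-1]; [chm_comul] and [chm_counit] make
    it group-like, and [chm_mul] makes [F] multiplicative. *)
Lemma fourier_surj P : central_hopf_map P -> exists F,
  [/\ {in Z &, {morph F : x y / (x * y)%g}}, forall y, y \in Z -> F y \in Z
    & forall z s, fourier F z s = P z s].
Proof.
move=> hP; pose E y s := \sum_(z in Z) b y z^-1%g * P z s.
have PZ z s : z \notin Z -> P z s = 0.
  by move=> zZ; apply: contraNeq zZ => /(chm_central hP)[/centerTP].
have E1 y : y \in Z -> \sum_s E y s = 1.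
  move=> yZ; rewrite exchange_big /= (bigD1 1%g) //=.
  rewrite -mulr_sumr (chm_counit hP) eqxx invg1 bC b1l // mulr1 big1 ?addr0 // => z /andP[_ /negPf z1].
  by rewrite -mulr_sumr (chm_counit hP) z1 mulr0.
have sZ (H : gT -> k) : \sum_(z in Z) H z = \sum_z (z \in Z)%:R * H z.
  by rewrite big_mkcond; apply: eq_bigr => z _; case: (z \in Z); rewrite ?(mul1r, mul0r).
have EE y s t : y \in Z -> E y s * E y t = (s == t)%:R * E y s.
  move=> yZ; rewrite /E big_distrlr /=.
  transitivity (\sum_(z in Z) \sum_(w in Z) b y w^-1%g * (P z s * P (z^-1 * w)%g t)).
    apply: eq_bigr => z zZ; rewrite [RHS](reindex_inj (mulgI z)).
    rewrite [RHS](eq_bigl [in Z]) /= => [|w]; last by rewrite groupMl.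
    by apply: eq_bigr => w wZ; rewrite invMg bMr ?groupV // mulKg mulrACA [b y w^-1%g * _]mulrC.
  rewrite exchange_big mulr_sumr; apply: eq_bigr => w wZ /=.
  rewrite -mulr_sumr mulrCA -(chm_comul hP); congr (_ * _).
  rewrite sZ; apply: eq_bigr => z _.
  by case: (boolP (z \in Z)) => [_|/PZ ->]; rewrite ?mul1r // !mul0r.
have EM y y' t : y \in Z -> y' \in Z -> E (y * y')%g t = \sum_s E y s * E y' (s^-1 * t)%g.
  move=> yZ yZ'; under [RHS]eq_bigr => s _ do rewrite big_distrlr /=.
  rewrite exchange_big; apply: eq_bigr => z zZ /=.
  transitivity (\sum_(z' in Z) b y z^-1%g * b y' z'^-1%g * ((z == z')%:R * P z t)).
    rewrite (bigD1 z) //= eqxx mul1r -bM ?groupV // big1 ?addr0 // => x /andP[_ ne].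
    by rewrite eq_sym (negPf ne) mul0r mulr0.
  rewrite exchange_big; apply: eq_bigr => z' zZ' /=.
  rewrite -(chm_mul hP) mulr_sumr; apply: eq_bigr => s _.
  by rewrite mulrACA.
(* For [y] in Z exactly one [s] qualifies, so the default is never taken; the inverse follows the
   convention of [fourier_inv]. *)
pose F y := odflt 1%g [pick s | E y s^-1%g != 0].
have EF y s : y \in Z -> E y s = (F y == s^-1)%g%:R.
  move=> yZ; have [s0 Es0] := idempotent_family (E1 y yZ) (fun s t => EE y s t yZ).
  rewrite Es0 /F; case: pickP => [t|/(_ s0^-1%g)]; last by rewrite Es0 invgK eqxx oner_eq0.
  rewrite Es0; have [<- _|_] := eqVneq t^-1%g s0; last by rewrite eqxx.
  by rewrite -[in RHS](inj_eq invg_inj) invgK eq_sym.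
have FZ y : y \in Z -> F y \in Z.
  move=> yZ; rewrite -groupV; apply: contraT => nZ.
  have := EF y (F y)^-1%g yZ; rewrite invgK eqxx /E big1 => [/esym/eqP|z _].
    by rewrite oner_eq0.
  apply/eqP; rewrite mulf_eq0; apply/orP; right; apply: contraNT nZ.
  by move=> /(chm_central hP)[_ /centerTP].
exists F; split.
- move=> x y xZ yZ; apply/eqP; apply: contraT => ne.
  have := EM x y (F (x * y))^-1%g xZ yZ; rewrite EF ?groupM // invgK eqxx.
  rewrite big1 => [/eqP|s _]; first by rewrite oner_eq0.
  rewrite !EF //; case: eqP => [e|_]; rewrite ?mul0r // mul1r; case: eqP => // e'.
  have /centerTP xC := FZ x xZ.
  by rewrite xC e e' invMg !invgK mulgK eqxx in ne.
- exact: FZ.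
move=> z s; rewrite /fourier; case: (boolP (z \in Z)) => [zZ|/PZ e]; last by rewrite mul0r e.
rewrite mul1r; apply: (mulfI cardZ); rewrite mulVKf //.
under eq_bigr => y yZ do rewrite -EF // /E mulr_sumr.
rewrite exchange_big (bigD1 z) //= [X in _ + X]big1 ?addr0 => [|x /andP[xZ xz]].
  under eq_bigr => y yZ do rewrite mulrA -bMr ?groupV // mulgV bC b1l // mul1r.
  by rewrite sumr_const mulr_natl.
under eq_bigr => y yZ do rewrite mulrA -bMr ?groupV //.
rewrite -mulr_suml pairing_suml ?groupM ?groupV // -eq_mulgV1 eq_sym (negPf xz).
by rewrite mulr0 mul0r.
Qed.

End Fourier.

(** * Group-like elements and the matrices of the components *)

Section Components.
Variables (k : fieldType) (gT : finGroupType).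
Implicit Types (g h s t x y : gT).
Local Notation kfun := {ffun gT -> k^o}.
Local Notation dbl := {ffun gT * gT -> k^o}.
Implicit Types (chi : kfun).

Definition kmul chi chi' : kfun := [ffun g => chi g * chi' g].

Lemma dual_kone : dual_group (kone k gT).
Proof. by split=> [g|g h]; rewrite !ffunE ?oner_eq0 ?mulr1. Qed.

Lemma dual_kmul chi chi' : dual_group chi -> dual_group chi' -> dual_group (kmul chi chi').
Proof.
move=> [c0 cM] [d0 dM]; split=> [g|g h]; rewrite !ffunE; first exact: mulf_neq0.
by rewrite cM dM mulrACA.
Qed.

Lemma koneE x : kone k gT x = 1 :> k.
Proof. by rewrite ffunE. Qed.

Lemma kmul1l chi : kmul (kone k gT) chi = chi.
Proof. by apply/ffunP=> g; rewrite !ffunE mul1r. Qed.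

Lemma kmul1r chi : kmul chi (kone k gT) = chi.
Proof. by apply/ffunP=> g; rewrite !ffunE mulr1. Qed.

Lemma dual_1 chi : dual_group chi -> chi 1%g = 1.
Proof. by move=> [c0 cM]; apply: (mulfI (c0 1%g)); rewrite -cM mulg1 mulr1. Qed.

Lemma dual_conj chi x y : dual_group chi -> chi (y^-1 * x * y)%g = chi x.
Proof.
by move=> hc; have [c0 cM] := hc; rewrite !cM mulrAC -cM mulVg dual_1 // mul1r.
Qed.

Local Notation glike chi h := (smash chi (delta k h) : dbl).

Lemma glikeE chi h x y : glike chi h (x, y) = chi x * (y == h)%:R :> k.
Proof. by rewrite !ffunE. Qed.

Lemma glike_mulE (X : dbl) chi h x y : dual_group chi ->
  dmul X (glike chi h) (x, y) = X (x, y * h^-1)%g * chi x :> k.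
Proof.
move=> hc; rewrite dmulE.
rewrite -[RHS](sum_kronl (y * h^-1)%g (fun c => X (x, c) * chi x)).
apply: eq_bigr => c _; rewrite glikeE dual_conj // mulrA mulrC; congr (_%:R * _).
congr nat_of_bool; rewrite -(inj_eq (mulgI c)) mulKVg -(inj_eq (mulIg h^-1%g)) mulgK.
by rewrite eq_sym.
Qed.

Lemma glike_mul chi chi' h h' : dual_group chi' ->
  dmul (glike chi h) (glike chi' h') = glike (kmul chi chi') (h * h')%g.
Proof.
move=> hc; apply/ffunP=> -[x y]; rewrite glike_mulE // !glikeE ffunE mulrAC.
by rewrite -[in RHS](inj_eq (mulIg h'^-1%g)) mulgK.
Qed.

Lemma glike_inj chi chi' h h' : dual_group chi ->
  glike chi h = glike chi' h' -> chi = chi' /\ h = h'.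
Proof.
move=> [c0 _] /ffunP e; have e1 : h = h'.
  have := e (1%g, h); rewrite !glikeE eqxx mulr1; case: eqP => // _ /eqP.
  by rewrite mulr0 (negPf (c0 _)).
by split=> //; apply/ffunP=> x; have := e (x, h); rewrite !glikeE e1 eqxx !mulr1.
Qed.

Lemma glike_comul chi h : dual_group chi ->
  dcomul (glike chi h) = tens (glike chi h) (glike chi h).
Proof.
move=> [_ cM]; apply/ffunP=> -[[g1 h1] [g2 h2]].
rewrite dcomulE tensE !glikeE cM; have [->|_] := eqVneq h1 h.
  by rewrite !mulr1 [h == h2]eq_sym mulrC mulrA [chi g2 * _]mulrC.
by rewrite !(mulr0, mul0r).
Qed.

Lemma glike_counit chi h : dual_group chi -> dcounit (glike chi h) = 1.
Proof.
move=> hc; rewrite dcounitE -[RHS](sum_kronr h (fun=> 1)); apply: eq_bigr => y _.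
by rewrite glikeE dual_1.
Qed.

Lemma glikeP (X : dbl) : dcomul X = tens X X -> dcounit X = 1 ->
  exists chi h, dual_group chi /\ X = glike chi h.
Proof.
move=> /ffunP XX; rewrite dcounitE => X1.
have XE g1 h1 g2 h2 : X (g1, h1) * X (g2, h2) = (h1 == h2)%:R * X (g2 * g1, h1)%g :> k.
  by rewrite -dcomulE XX tensE.
(* At the identity of G the group-like equations say that the coefficients are orthogonal
   idempotents of sum 1; multiplying by the surviving one then confines all of [X] to the column
   [h]. *)
have [h hE] : exists h, forall y, X (1%g, y) = (y == h)%:R :> k.
  by apply: idempotent_family => // s t; rewrite XE mulg1.
exists [ffun g => X (g, h)], h; split; last first.
  apply/ffunP=> -[x y]; rewrite glikeE ffunE; have := XE 1%g h x y; rewrite hE eqxx mul1r mulg1 => ->.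
  by rewrite mulrC eq_sym.
split=> [g|g g']; rewrite !ffunE; last by rewrite [RHS]mulrC XE eqxx mul1r.
have := XE g h g^-1%g h; rewrite eqxx mulVg hE eqxx mulr1 => e.
by apply/eqP => e0; move: e; rewrite e0 mul0r => /esym/eqP; rewrite oner_eq0.
Qed.

Section Endo.
Variable psi : 'End(dbl).
Hypothesis psiH : hopf_endo psi.

Lemma hopf_endo_glike : exists R : kfun -> gT -> kfun, exists Q : kfun -> gT -> gT,
  forall chi h, dual_group chi ->
    dual_group (R chi h) /\ psi (glike chi h) = glike (R chi h) (Q chi h).
Proof.
have [_ _ psie psiD _] := psiH.
have ex (p : kfun * gT) : exists q : kfun * gT, dual_group p.1 ->
    dual_group q.1 /\ psi (glike p.1 p.2) = glike q.1 q.2.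
  case: p => chi h /=; have [hc|nhc] := pselect (dual_group chi); last by exists (chi, h).
  have [||chi' [h' [hc' e]]] := glikeP (X := psi (glike chi h)).
  - by rewrite psiD glike_comul // tens_map_tens.
  - by rewrite psie glike_counit.
  by exists (chi', h').
have [f fP] := boolp.choice ex.
by exists (fun chi h => (f (chi, h)).1), (fun chi h => (f (chi, h)).2) => chi h /(fP (chi, h)).
Qed.

(** The restriction of [psi] to k^G and its two projections: [Pc g s] is the coefficient of [s] in
    p(e_g), and [Uc g x] is the value of u(e_g) at [x]. *)
Definition Xc g : dbl := psi (dbas k (g, 1%g)).
Definition Pc g s : k := Xc g (1%g, s).
Definition Uc g x : k := \sum_s Xc g (x, s).

Lemma Xc_comul g g1 h1 g2 h2 : (h1 == h2)%:R * Xc g (g2 * g1, h1)%g =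
  \sum_c Xc c (g1, h1) * Xc (g * c^-1)%g (g2, h2) :> k.
Proof.
have [_ _ _ psiD _] := psiH.
rewrite -dcomulE psiD tens_mapE sum_pair; apply: eq_bigr => c _.
rewrite (bigD1 1%g) //= [X in _ + X]big1 ?addr0 => [|u u1]; last first.
  by rewrite big1 // => -[d w] _; rewrite dcomulE dbasE xpair_eqE (negPf u1) andbF mulr0 mul0r.
rewrite (bigD1 (g * c^-1, 1)%g) //= [X in _ + X]big1 ?addr0 => [|[d w] ne].
  by rewrite dcomulE dbasE eqxx mulgKV eqxx !mul1r.
rewrite dcomulE dbasE xpair_eqE eqxx andbT.
have [e1|_] := eqVneq 1%g w; last by rewrite !mul0r.
have [e|_] := eqVneq (d * c)%g g; last by rewrite mulr0 mul0r.
by rewrite -e -e1 mulgK eqxx in ne.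
Qed.

Lemma dmul_iota g h : dmul (dbas k (g, 1%g)) (dbas k (h, 1%g)) = (g == h)%:R *: dbas k (g, 1%g).
Proof.
apply/ffunP=> -[x y]; rewrite dmulE ffunE !dbasE.
rewrite (bigD1 1%g) //= big1 ?addr0 => [|c c1]; last first.
  by rewrite dbasE xpair_eqE (negPf c1) andbF mul0r.
rewrite !dbasE invg1 mul1g mulg1 mul1g !xpair_eqE eqxx andbT /GRing.scale /= -!natrM !mulnb.
by congr (nat_of_bool _)%:R; case: (eqVneq x g) => [->|_]; rewrite ?andbF.
Qed.

Lemma Xc_mul g h : dmul (Xc g) (Xc h) = (g == h)%:R *: Xc g.
Proof. by have [_ psiM _ _ _] := psiH; rewrite -psiM dmul_iota linearZ. Qed.

Lemma Pc_mul g h t :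
  \sum_s Pc g s * Pc h (s^-1 * t)%g = (g == h)%:R * Pc g t.
Proof.
have /ffunP/(_ (1%g, t)) := Xc_mul g h; rewrite dmulE ffunE => e.
by apply: etrans e; apply: eq_bigr => s _; rewrite mulg1 mulVg.
Qed.

Lemma Xc_unit x s : \sum_g Xc g (x, s) = (s == 1%g)%:R :> k.
Proof.
have [psi1 _ _ _ _] := psiH; rewrite -(dunitE k x) -psi1 lfun_dbas sum_pair.
apply: eq_bigr => g _; rewrite (bigD1 1%g) //= big1 => [|c c1].
  by rewrite addr0 dunitE eqxx mul1r.
by rewrite dunitE (negPf c1) mul0r.
Qed.

Lemma Pc_counit g : \sum_s Pc g s = (g == 1%g)%:R.
Proof.
have [_ _ psie _ _] := psiH; rewrite -dcounitE psie dcounitE.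
rewrite (bigD1 1%g) //= dbasE xpair_eqE eqxx andbT big1 ?addr0 1?eq_sym // => c c1.
by rewrite dbasE xpair_eqE (negPf c1) andbF.
Qed.

Lemma Pc_comul g s t : \sum_c Pc c s * Pc (g * c^-1)%g t = (s == t)%:R * Pc g s.
Proof. by rewrite /Pc -Xc_comul mulg1. Qed.

Lemma Pc_antipode g s : Pc g^-1%g s^-1%g = Pc g s.
Proof.
have [_ _ _ _ psiS] := psiH.
have e : dantipode (dbas k (g, 1%g)) = dbas k (g^-1, 1)%g.
  apply/ffunP=> -[x y]; rewrite dantipodeE !dbasE !xpair_eqE [(y^-1 == 1)%g]eq_invg1.
  have [->|_] := eqVneq y 1%g; last by rewrite !andbF.
  by rewrite invg1 mul1g mulg1 !andbT -[in RHS](inj_eq invg_inj) invgK.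
rewrite /Pc /Xc -e -psiS dantipodeE !invgK; congr (psi _ (_, _)).
by rewrite invg1 mulg1 mulgV.
Qed.

Lemma Xc_UP g x s : Xc g (x, s) = \sum_c Uc c x * Pc (g * c^-1)%g s :> k.
Proof.
transitivity (\sum_c \sum_t Xc c (x, t) * Pc (g * c^-1)%g s); last first.
  by apply: eq_bigr => c _; rewrite mulr_suml.
rewrite exchange_big /= -[LHS](sum_kronl s (fun t => Xc g (x, t))).
by apply: eq_bigr => t _; rewrite -{1}[x]mul1g Xc_comul.
Qed.

(** Either tensor leg of the coproduct may be evaluated at 1, and kG is cocommutative; so u and p
    commute under convolution. Comparing this with [Xc_UP] is what yields commutation with [w] in
    [Pc_class]. *)
Lemma Xc_PU g x s : Xc g (x, s) = \sum_c Pc c s * Uc (g * c^-1)%g x :> k.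
Proof.
transitivity (\sum_c \sum_t Pc c s * Xc (g * c^-1)%g (x, t)); last first.
  by apply: eq_bigr => c _; rewrite mulr_sumr.
rewrite exchange_big /= -[LHS](sum_kronl s (fun=> Xc g (x, s))).
by apply: eq_bigr => t _; rewrite -{1}[x]mulg1 eq_sym Xc_comul.
Qed.

Lemma Uc_comul g x y : Uc g (y * x)%g = \sum_c Uc c x * Uc (g * c^-1)%g y.
Proof.
transitivity (\sum_c \sum_s \sum_t Xc c (x, s) * Xc (g * c^-1)%g (y, t)); last first.
  by apply: eq_bigr => c _; rewrite big_distrlr.
rewrite exchange_big; apply: eq_bigr => s _ /=; rewrite exchange_big /=.
rewrite -[LHS](sum_kronl s (fun=> Xc g (y * x, s)%g)).
by apply: eq_bigr => t _; rewrite eq_sym Xc_comul.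
Qed.

Lemma dbas_glike g h : dbas k (g, h) = dmul (dbas k (g, 1%g)) (glike (kone k gT) h).
Proof.
apply/ffunP=> -[x y]; rewrite glike_mulE; last exact: dual_kone.
by rewrite koneE mulr1 !dbasE !xpair_eqE -[y == h](inj_eq (mulIg h^-1%g)) mulgV.
Qed.

Lemma glike_dbas g h : dmul (glike (kone k gT) h) (dbas k (g, 1%g)) = dbas k (h * g * h^-1, h)%g.
Proof.
apply/ffunP=> -[x y]; rewrite dmulE (bigD1 h) //= big1 ?addr0 => [|c ch]; last first.
  by rewrite glikeE (negPf ch) mulr0 mul0r.
rewrite glikeE eqxx koneE mulr1 mul1r !dbasE !xpair_eqE; congr (nat_of_bool (_ && _))%:R.
  by apply/eqP/eqP => [<-|->]; rewrite !mulgA ?(mulgV, mulVg) mul1g ?(mulgK, mulgKV).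
by rewrite -[LHS](inj_eq (mulgI h)) mulKVg mulg1.
Qed.

End Endo.
End Components.

(** * Centrality of the component p *)

Section Centrality.
Variables (k : fieldType) (gT : finGroupType).
Implicit Types (g h s t x y : gT).
Local Notation kfun := {ffun gT -> k^o}.
Local Notation dbl := {ffun gT * gT -> k^o}.
Implicit Types (chi : kfun).
Local Notation glike chi h := (smash chi (delta k h) : dbl).

(** For trivial [chi], [R] and [Q] are the components r and v; for [h = 1] they are u and p on
    characters. *)
Definition glike_action (psi : dbl -> dbl) (R : kfun -> gT -> kfun)
    (Q : kfun -> gT -> gT) :=
  forall chi h, dual_group chi ->
    dual_group (R chi h) /\ psi (glike chi h) = glike (R chi h) (Q chi h).

Section OneEndo.
Variables (psi : 'End(dbl)) (R : kfun -> gT -> kfun) (Q : kfun -> gT -> gT).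
Hypothesis psiH : hopf_endo psi.
Hypothesis RQ : glike_action psi R Q.
Local Notation one := (kone k gT).

Lemma glike_actionM chi chi' h h' : dual_group chi -> dual_group chi' ->
  R (kmul chi chi') (h * h')%g = kmul (R chi h) (R chi' h') /\
  Q (kmul chi chi') (h * h')%g = (Q chi h * Q chi' h')%g.
Proof.
have [_ psiM _ _ _] := psiH => hc hc'.
have [d e] := RQ (h * h')%g (dual_kmul hc hc').
have [d1 e1] := RQ h hc; have [d2 e2] := RQ h' hc'.
by apply: glike_inj => //; rewrite -e -glike_mul // psiM e1 e2 glike_mul.
Qed.

Lemma comp_rE h : comp_r psi h = R one h.
Proof.
have [_ e] := RQ h (dual_kone k gT); rewrite /comp_r e.
by apply/ffunP=> x; rewrite ffunE; under eq_bigr => y _ do rewrite glikeE; rewrite sum_kronr.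
Qed.

Lemma comp_vE h : comp_v psi h = delta k (Q one h).
Proof.
have [d e] := RQ h (dual_kone k gT); rewrite /comp_v e.
by apply/ffunP=> x; rewrite !ffunE /= dual_1 // mul1r.
Qed.

Lemma act_vM : {morph Q one : h h' / (h * h')%g}.
Proof.
move=> h h'; have [_] := glike_actionM h h' (dual_kone k gT) (dual_kone k gT).
by rewrite kmul1l.
Qed.

Lemma act_r0 h x : R one h x != 0.
Proof. by have [[]] := RQ h (dual_kone k gT). Qed.

Lemma act_rMr h x y : R one h (x * y)%g = R one h x * R one h y.
Proof. by have [[]] := RQ h (dual_kone k gT). Qed.

Lemma act_rMl h h' x : R one (h * h')%g x = R one h x * R one h' x.
Proof.
have [] := glike_actionM h h' (dual_kone k gT) (dual_kone k gT).
by rewrite kmul1l => -> _; rewrite ffunE.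
Qed.

Lemma act_r1 x : R one 1%g x = 1.
Proof. by apply: (mulfI (act_r0 1%g x)); rewrite -act_rMl mulg1 mulr1. Qed.

Lemma psi_dbasE g h x y : psi (dbas k (g, h)) (x, y) =
  Xc psi g (x, y * (Q one h)^-1)%g * R one h x :> k.
Proof.
have [_ psiM _ _ _] := psiH; have [d e] := RQ h (dual_kone k gT).
by rewrite dbas_glike psiM e glike_mulE.
Qed.

Lemma psi_dbas_sum g h x :
  \sum_y psi (dbas k (g, h)) (x, y) = Uc psi g x * R one h x :> k.
Proof.
rewrite mulr_suml [RHS](reindex_inj (mulIg (Q one h)^-1%g)).
by apply: eq_bigr => y _; rewrite psi_dbasE.
Qed.

(** Apply [psi] to the relation (1 # h)(e_g # 1) = (e_(h g h^-1) # 1)(1 # h), and cancel the nonzero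
    value of r(h). *)
Lemma Xc_equiv g h x y :
  Xc psi g ((Q one h)^-1 * x * Q one h, (Q one h)^-1 * y * Q one h)%g =
  Xc psi (h * g * h^-1)%g (x, y).
Proof.
have [_ psiM _ _ _] := psiH; have [d e] := RQ h (dual_kone k gT).
have := congr1 psi (glike_dbas k g h); rewrite (dbas_glike k (h * g * h^-1)%g) !psiM !e.
move/ffunP/(_ (x, y * Q one h)%g); rewrite glike_mulE // mulgK dmulE.
rewrite (bigD1 (Q one h)) //= big1 ?addr0 => [|c ch]; last first.
  by rewrite glikeE (negPf ch) mulr0 mul0r.
rewrite glikeE eqxx mulr1 mulrC mulgA => /(mulIf (act_r0 h x)) <-.
by [].
Qed.

End OneEndo.

Section TwoEndos.
Variables (psi psi' : 'End(dbl)).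
Variables (R R' : kfun -> gT -> kfun) (Q Q' : kfun -> gT -> gT).
Hypothesis psiH : hopf_endo psi.
Hypothesis psiH' : hopf_endo psi'.
Hypothesis psiK : forall X, psi (psi' X) = X.
Hypothesis RQ : glike_action psi R Q.
Hypothesis RQ' : glike_action psi' R' Q'.
Hypothesis hG : purely_nonabelian gT.
Local Notation one := (kone k gT).
Local Notation r := (R one).
Local Notation v := (Q one).
Local Notation r' := (R' one).
Local Notation v' := (Q' one).

Let done1 := dual_kone k gT.

Lemma act_v_inj : injective v'.
Proof.
have dr' h : dual_group (r' h) by have [] := RQ' h done1.
have QC chi h : dual_group chi -> commute (Q chi 1%g) (v h).
  move=> hc; have [_] := glike_actionM psiH RQ 1%g h hc done1.
  have [_] := glike_actionM psiH RQ h 1%g done1 hc.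
  by rewrite kmul1l kmul1r mulg1 mul1g /commute => <- <-.
have QCC chi chi' : dual_group chi -> dual_group chi' ->
    commute (Q chi 1%g) (Q chi' 1%g).
  move=> hc hc'; have [_] := glike_actionM psiH RQ 1%g 1%g hc hc'.
  have [_] := glike_actionM psiH RQ 1%g 1%g hc' hc.
  have -> : kmul chi' chi = kmul chi chi' by apply/ffunP=> g; rewrite !ffunE mulrC.
  by rewrite /commute => <- <-.
pose z h := Q (r' h) 1%g.
have zE h : h = (z h * v (v' h))%g.
  have [_ e] := RQ' h done1; have [d2 e2] := RQ (v' h) (dr' h).
  have := psiK (glike one h); rewrite e e2 => /(glike_inj d2)[_ e3].
  have [_] := glike_actionM psiH RQ 1%g (v' h) (dr' h) done1.
  by rewrite kmul1r mul1g e3.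
(* By [zE], every element is a product of some p(chi) and some v(h'). The values of p on characters
   commute with each other and with those of v, because characters are invariant under
   conjugation. *)
have zC h y : commute (z h) y.
  by rewrite [y]zE; apply: commuteM; [apply: QCC|apply: QC].
have zM : {morph z : x y / (x * y)%g}.
  move=> x y; have [rM _] := glike_actionM psiH' RQ' x y done1 done1.
  have [_ <-] := glike_actionM psiH RQ 1%g 1%g (dr' x) (dr' y).
  by rewrite mulg1 -rM kmul1l.
have v'M := act_vM psiH' RQ'; have vM := act_vM psiH RQ.
have v1 : v 1%g = 1%g by apply: (mulgI (v 1%g)); rewrite -vM !mulg1.
have v'1 : v' 1%g = 1%g by apply: (mulgI (v' 1%g)); rewrite -v'M !mulg1.
(* If [v' x = v' y], then [v'] kills [x^-1 y], and [zE] makes it a fixed point of [z]. *)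
move=> x y e; apply/eqP; rewrite eq_mulVg1; apply/eqP.
apply: (central_endo_fix hG zM zC); rewrite [RHS]zE v'M -e -v'M mulVg v'1 v1.
by rewrite mulg1.
Qed.

(* W and Zc are the matrices of the two factors of the identity
   a = u(u'(a_1)) r(p'(a_2)) read in the dual basis. *)
Let W g y : k := \sum_a Uc psi' g a * Uc psi a y.
Let Zc g x : k := \sum_c Pc psi' g c * r c x.

Lemma Pc_class g y s : Pc psi' (y^-1 * g * y)%g s = Pc psi' g s.
Proof.
have rMl := act_rMl psiH RQ.
(* [Zc _ x] is the algebra map a |-> r(p'(a)) evaluated at [x], hence a character of the algebra
   k^G, hence evaluation at a point [z]. *)
have exz x : exists z, forall d, Zc d x = (d == z)%:R.
  apply: idempotent_family => [|g1 g2].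
    rewrite exchange_big /= -(act_r1 psiH RQ x) -[RHS](sum_kronl 1%g (r^~ x)).
    by apply: eq_bigr => c _; rewrite -mulr_suml (Xc_unit psiH').
  transitivity (\sum_c \sum_t Pc psi' g1 c * Pc psi' g2 (c^-1 * t)%g * r t x).
    rewrite big_distrlr; apply: eq_bigr => c _ /=.
    rewrite [RHS](reindex_inj (mulgI c)); apply: eq_bigr => d _ /=.
    by rewrite mulKg rMl mulrACA.
  rewrite exchange_big mulr_sumr; apply: eq_bigr => t _ /=.
  by rewrite -mulr_suml (Pc_mul psiH') mulrA.
have [z zE] := boolp.choice exz.
have sum1 (F : gT -> k) d : \sum_c F c * (d == c)%:R = F d.
  by rewrite -[RHS](sum_kronr d F); apply: eq_bigr => c _; rewrite eq_sym.
(* On the diagonal this is the k^G-component of psi(psi'(e_g # 1)) at [x], a Kronecker delta, which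
   determines [W]. Off the diagonal, the expansions by [Xc_UP] and [Xc_PU] are compared to show that
   [z x1] commutes with [w y1]. *)
pose A g x y := \sum_a \sum_c Xc psi' g (a, c) * (Uc psi a y * r c x).
have A1 g1 x1 y1 : A g1 x1 y1 = W ((z x1)^-1 * g1)%g y1.
  transitivity (\sum_b W b y1 * Zc (g1 * b^-1)%g x1).
    rewrite /A; under eq_bigr => a _ do under eq_bigr => c _ do
      rewrite (Xc_UP psiH') mulr_suml.
    rewrite exchange_big /=; under eq_bigr => c _ do rewrite exchange_big /=.
    rewrite exchange_big; apply: eq_bigr => b _ /=.
    rewrite exchange_big big_distrlr; apply: eq_bigr => a _ /=.
    by apply: eq_bigr => c _; rewrite mulrACA.
  under eq_bigr => b _.
    rewrite zE (_ : (_ == _) = ((z x1)^-1 * g1 == b)%g); last first.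
      by apply/eqP/eqP => [<-|<-]; rewrite !invMg ?invgK -?mulgA ?mulVg ?mulKVg ?mulg1 ?mulKg ?mulgKV.
    over.
  by rewrite sum1.
have A2 g1 x1 y1 : A g1 x1 y1 = W (g1 * (z x1)^-1)%g y1.
  transitivity (\sum_b Zc b x1 * W (g1 * b^-1)%g y1).
    rewrite /A; under eq_bigr => a _ do under eq_bigr => c _ do
      rewrite (Xc_PU psiH') mulr_suml.
    rewrite exchange_big /=; under eq_bigr => c _ do rewrite exchange_big /=.
    rewrite exchange_big; apply: eq_bigr => b _ /=.
    rewrite big_distrlr; apply: eq_bigr => a _ /=.
    by apply: eq_bigr => c _; rewrite [Uc _ _ _ * r _ _]mulrC mulrACA.
  under eq_bigr => b _ do rewrite zE.
  by rewrite sum_kronl.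
have Axx g1 x1 : A g1 x1 x1 = (x1 == g1)%:R.
  transitivity (\sum_y1 dbas k (g1, 1%g) (x1, y1)); last first.
    rewrite -[RHS](@sum_kronr k gT 1%g (fun=> (x1 == g1)%:R)); apply: eq_bigr => y1 _.
    by rewrite dbasE xpair_eqE -mulnb natrM.
  under [RHS]eq_bigr => y1 _ do rewrite -[dbas _ _]psiK lfun_dbas sum_pair.
  rewrite exchange_big; apply: eq_bigr => a _ /=.
  rewrite exchange_big; apply: eq_bigr => c _ /=.
  by rewrite -mulr_sumr (psi_dbas_sum psiH RQ).
pose w x := (x * (z x)^-1)%g.
have WE b x : W b x = (b == w x)%:R.
  rewrite -[b](mulgK (z x)) -A2 Axx; congr (nat_of_bool _)%:R.
  by rewrite /w mulgK -(inj_eq (mulIg (z x)^-1%g)) mulgK eq_sym.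
have zw x1 y1 : commute (z x1) (w y1).
  have := A1 (z x1 * w y1)%g x1 y1; rewrite A2 !WE mulKg eqxx /commute.
  have [e _|_ /eqP] := eqVneq (z x1 * w y1 * (z x1)^-1)%g (w y1).
    by rewrite -[in RHS]e mulgKV.
  by rewrite eq_sym oner_eq0.
have zconv x1 y1 : z (x1 * y1)%g = (z y1 * z x1)%g.
  have e : Zc (z y1 * z x1)%g (x1 * y1)%g =
      \sum_b Zc b x1 * Zc (z y1 * z x1 * b^-1)%g y1.
    transitivity (\sum_c \sum_d \sum_b Pc psi' b c *
        Pc psi' (z y1 * z x1 * b^-1)%g d * (r c x1 * r d y1)); last first.
      under eq_bigr => c _ do rewrite exchange_big /=.
      rewrite exchange_big; apply: eq_bigr => b _ /=.
      rewrite big_distrlr; apply: eq_bigr => c _; apply: eq_bigr => d _.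
      by rewrite mulrACA.
    apply: eq_bigr => c _; rewrite (act_rMr RQ).
    rewrite -(sum_kronl c (fun d => Pc psi' (z y1 * z x1)%g c * (r c x1 * r d y1))).
    apply: eq_bigr => d _.
    by rewrite -[RHS]mulr_suml (Pc_comul psiH') -mulrA eq_sym.
  move: e; rewrite zE; under eq_bigr => b _ do rewrite zE.
  rewrite sum_kronl zE mulgK eqxx; case: eqP => // _ /esym/eqP.
  by rewrite oner_eq0.
(* Each [r c] takes commuting values, so [z (x1 * y1) = z (y1 * x1)]; as [z] reverses products by
   [zconv], its values commute. *)
have zz x1 y1 : commute (z x1) (z y1).
  rewrite /commute -!zconv; have := zE (y1 * x1)%g (z (x1 * y1)%g).
  have -> : Zc (z (x1 * y1)%g) (y1 * x1)%g = Zc (z (x1 * y1)%g) (x1 * y1)%g.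
    by apply: eq_bigr => c _; rewrite !(act_rMr RQ) [r c y1 * _]mulrC.
  by rewrite zE eqxx; case: eqP => // _ /eqP; rewrite oner_eq0.
have zM : {morph z : x1 y1 / (x1 * y1)%g} by move=> x1 y1; rewrite zconv zz.
have zC x1 y1 : commute (z x1) y1.
  by rewrite -[y1](mulgKV (z y1)); apply: commuteM; [exact: zw|exact: zz].
have w_inj : injective w.
  move=> x1 y1 e; apply/eqP; rewrite eq_mulVg1; apply/eqP.
  apply: (central_endo_fix hG zM zC).
  rewrite -[in RHS](mulgKV (z y1) y1) -/(w y1) -e /w !mulgA mulVg mul1g zM.
  congr (_ * _)%g; apply: (mulgI (z x1)); rewrite -zM !mulgV.
  by apply: (mulgI (z 1%g)); rewrite -zM !mulg1.
have [wi wK wiK] := injF_bij w_inj.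
(* Contracting the k^G-leg of psi'(e_d # 1) with [u], through both expansions of [Xc], moves [w y1]
   across the index of [Pc]. Surjectivity of [w] then gives all of G. *)
have WP t d y1 : Pc psi' (d * (w y1)^-1)%g t = Pc psi' ((w y1)^-1 * d)%g t.
  transitivity (\sum_a Xc psi' d (a, t) * Uc psi a y1).
    rewrite -[LHS](sum_kronl (w y1) (fun b => Pc psi' (d * b^-1)%g t)).
    under eq_bigr => b _ do rewrite -WE mulr_suml.
    rewrite exchange_big; apply: eq_bigr => a _ /=.
    rewrite (Xc_UP psiH') mulr_suml; apply: eq_bigr => b _.
    by rewrite mulrAC.
  symmetry; rewrite -[LHS](sum_kronr ((w y1)^-1 * d)%g (fun b => Pc psi' b t)).
  transitivity (\sum_b Pc psi' b t * W (d * b^-1)%g y1).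
    apply: eq_bigr => b _; rewrite WE; congr (_ * (nat_of_bool _)%:R).
    by apply/eqP/eqP => [->|<-]; rewrite invMg invgK ?mulgA ?mulgV ?mul1g // mulgKV.
  under eq_bigr => b _ do rewrite mulr_sumr.
  rewrite exchange_big; apply: eq_bigr => a _ /=.
  rewrite (Xc_PU psiH') mulr_suml; apply: eq_bigr => b _.
  by rewrite mulrA.
by rewrite -[y]wiK -mulgA -WP mulgK.
Qed.

End TwoEndos.

Lemma Pc_central_hopf (psi : haut k gT) : purely_nonabelian gT ->
  central_hopf_map (Pc psi).
Proof.
move=> hG; have [psiH _] := hautP psi.
have [psiH' _] := hautP (psi^-1)%g.
have [R [Q RQ]] := hopf_endo_glike psiH.
have [R' [Q' RQ']] := hopf_endo_glike psiH'.
have psiK X : (psi^-1)%g (psi X) = X :> dbl.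
  by rewrite -[LHS]comp_lfunE (_ : (_ \o _)%VF = (psi^-1 * psi)%g) // mulVg id_lfunE.
have class := Pc_class psiH' psiH psiK RQ' hG.
have v_inj := act_v_inj psiH' psiH psiK RQ' RQ hG.
have [vi vK viK] := injF_bij v_inj.
(* [Xc_equiv] trades conjugation of [s] by values of v for conjugation of [g]; as v is onto, every
   [t] is reached. *)
have classr g s t : Pc psi g (t^-1 * s * t)%g = Pc psi g s.
  rewrite -[t]viK; have := Xc_equiv psiH RQ g (vi t) 1%g s.
  rewrite mulg1 mulVg -/(Pc _ _ _) => ->; rewrite -/(Pc psi _ s).
  by have := class g (vi t)^-1%g s; rewrite invgK.
split.
- by move=> s; apply: Xc_unit.
- exact: Pc_mul.
- exact: Pc_counit.
- move=> w s s'; rewrite (reindex_inj invg_inj) (reindex_inj (mulIg w^-1%g)) /=.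
  transitivity (\sum_c Pc psi c s' * Pc psi (w * c^-1)%g s).
    by apply: eq_bigr => c _; rewrite !invMg !invgK mulgKV mulrC.
  by rewrite (Pc_comul psiH) eq_sym; case: eqP => [->|]; rewrite ?mul0r.
- exact: Pc_antipode.
move=> g s nz; split=> t.
  suff e : (t^-1 * g * t)%g = g by rewrite /commute -{2}e !mulgA mulgV mul1g.
  (* Distinct conjugates would index orthogonal idempotents p(e_g), yet by [class] these are equal,
     so they vanish. The second half is the dual argument with [Pc_comul]. *)
  apply: contraNeq nz => ne; have := Pc_mul psiH g (t^-1 * g * t)%g s.
  rewrite eq_sym (negPf ne) mul0r; under eq_bigr => c _ do rewrite class.
  by rewrite (Pc_mul psiH) eqxx mul1r => ->.
suff e : (t^-1 * s * t)%g = s by rewrite /commute -{2}e !mulgA mulgV mul1g.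
apply: contraNeq nz => ne; have := Pc_comul psiH g s (t^-1 * s * t)%g.
rewrite eq_sym (negPf ne) mul0r; under eq_bigr => c _ do rewrite classr.
by rewrite (Pc_comul psiH) eqxx mul1r => ->.
Qed.

End Centrality.

(** * The shape of the elements of K *)

Section Factorization.
Variables (k : fieldType) (gT : finGroupType).
Implicit Types (g h s t x y : gT) (r : gT -> gT -> k) (w v : {perm gT}).
Local Notation kfun := {ffun gT -> k^o}.
Local Notation dbl := {ffun gT * gT -> k^o}.
Local Notation glike chi h := (smash chi (delta k h) : dbl).
Local Notation one := (kone k gT).
Implicit Types f : haut k gT.

Lemma dbl_scaleE (c : k) (X : dbl) p : (c *: X) p = c * X p :> k.
Proof. by rewrite ffunE. Qed.

Lemma AutTP w : reflect {morph w : x y / (x * y)%g} (w \in Aut [set: gT]%SET)%g.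
Proof.
apply: (iffP idP) => [wA x y|wM]; first by rewrite (morphicP (Aut_morphic wA)) ?inE.
rewrite inE; apply/andP; split; first by apply/fintype.subsetP => x _; rewrite inE.
by apply/morphicP => x y _ _; apply: wM.
Qed.

(** Parameters of the map e_g # h |-> r(h)(g) e_(w g) # v h. [kd_conj] is compatibility with the
    smash product; [AutcP] relates it to Aut_c(G). *)
Record kdata r w v : Prop := KData {
  kd_r0 : forall h g, r h g != 0;
  kd_rMl : forall h h' g, r (h * h')%g g = r h g * r h' g;
  kd_rMr : forall h g g', r h (g * g')%g = r h g * r h g';
  kd_w : {morph w : x y / (x * y)%g};
  kd_v : {morph v : x y / (x * y)%g};
  kd_conj : forall g h, (w (h^-1 * g * h) = (v h)^-1 * w g * v h)%g }.

Lemma perm_morph1 w : {morph w : x y / (x * y)%g} -> w 1%g = 1%g.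
Proof. by move=> wM; apply: (mulgI (w 1%g)); rewrite -wM !mulg1. Qed.

Lemma perm_morphV w x : {morph w : x y / (x * y)%g} -> (w x^-1 = (w x)^-1)%g.
Proof. by move=> wM; apply: (mulgI (w x)); rewrite -wM !mulgV perm_morph1. Qed.

Lemma AutcP w v : {morph w : x y / (x * y)%g} -> {morph v : x y / (x * y)%g} ->
  (v * w^-1)%g \in Autc gT <->
  forall g h, (w (h^-1 * g * h) = (v h)^-1 * w g * v h)%g.
Proof.
move=> wM vM; have wVM : {morph (w^-1)%g : x y / (x * y)%g}.
  by move=> x y; apply: (@perm_inj _ w); rewrite wM !permKV.
rewrite inE; have -> : (v * w^-1)%g \in Aut [set: gT]%SET.
  by apply/AutTP=> x y; rewrite !permM vM wVM.
(* Pulled back along [w], the equation says that [h] and w^-1(v h) conjugate [g] alike, so their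
   quotient commutes with [g]. *)
have cE g h : (w (h^-1 * g * h) = (v h)^-1 * w g * v h)%g <->
    commute ((v * w^-1)%g h * h^-1)%g g.
  have -> : ((v h)^-1 * w g * v h)%g =
      w (((v * w^-1)%g h)^-1 * g * (v * w^-1)%g h)%g.
    by rewrite !wM permM perm_morphV // permKV.
  rewrite /commute; move: ((v * w^-1)%g h) => a; split=> [/perm_inj e|e].
    rewrite -mulgA -[(h^-1 * g)%g](mulgK h) e.
    by rewrite -!mulgA mulKVg.
  have e' : (a * (h^-1 * g * h) = g * a)%g by rewrite !mulgA e -!mulgA mulVg mulg1.
  by congr (w _); rewrite -[LHS](mulKg a) e' mulgA.
split=> [/forallP cen g h|cen /=].
  by apply/cE; have /centerTP/(_ g) := cen h.
by apply/forallP => h; apply/centerTP => g; apply/cE.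
Qed.

Definition kform r w v (f : dbl -> dbl) :=
  forall g h, f (dbas k (g, h)) = r h g *: dbas k (w g, v h).

Section KMap.
Variables (r : gT -> gT -> k) (w v : {perm gT}).
Hypothesis rwv : kdata r w v.

(** [twist] acts by pulling coefficients back, hence the inverses of [w] and [v]. *)
Definition kmap := twist (fun h g => r ((v^-1)%g h) ((w^-1)%g g)) (w^-1)%g (v^-1)%g.

Lemma hopf_aut_kmap : hopf_aut kmap.
Proof.
have [r0 rMl rMr wM vM cj] := rwv.
have wVM : {morph (w^-1)%g : x y / (x * y)%g}.
  by move=> x y; apply: (@perm_inj _ w); rewrite wM !permKV.
have vVM : {morph (v^-1)%g : x y / (x * y)%g}.
  by move=> x y; apply: (@perm_inj _ v); rewrite vM !permKV.
apply: hopf_aut_twist => //.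
- by move=> h h' g; rewrite vVM rMl.
- by move=> h g g'; rewrite wVM rMr.
by move=> g h; apply: (@perm_inj _ w); rewrite permKV cj !permKV.
Qed.

Definition kaut : haut k gT := mkhaut hopf_aut_kmap.

Lemma kautE : kform r w v kaut.
Proof.
move=> g h; apply/ffunP=> -[x y]; rewrite twistE dbl_scaleE !dbasE !xpair_eqE.
rewrite -{1}[g](permK w) -{1}[h](permK v) !(inj_eq perm_inj).
case: eqP => [->|_]; last by rewrite ?andbF !mulr0.
case: eqP => [->|_]; last by rewrite ?andbF !mulr0.
by rewrite !permK.
Qed.

End KMap.

Lemma kform_inj r r' w w' v v' (f : dbl -> dbl) : (forall h g, r h g != 0) ->
  kform r w v f -> kform r' w' v' f -> [/\ forall h g, r h g = r' h g, w = w' & v = v'].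
Proof.
move=> r0 e e'.
have key g h : [/\ r h g = r' h g, w g = w' g & v h = v' h].
  have /ffunP/(_ (w g, v h)) : r h g *: dbas k (w g, v h) = r' h g *: dbas k (w' g, v' h).
    by rewrite -e e'.
  rewrite !dbl_scaleE !dbasE eqxx xpair_eqE.
  case: eqP => [-> |_]; last by rewrite ?andbF mulr0 mulr1 => /eqP; rewrite (negPf (r0 _ _)).
  case: eqP => [-> |_]; last by rewrite ?andbF mulr0 mulr1 => /eqP; rewrite (negPf (r0 _ _)).
  by rewrite !mulr1.
by split=> [h g||]; [have [] := key g h|apply/permP=> x; have [] := key x x|apply/permP=> x; have [] := key x x].
Qed.

Lemma kformE r w v (f : 'End(dbl)) X g h : kform r w v f ->
  f X (w g, v h) = r h g * X (g, h) :> k.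
Proof.
move=> e; rewrite lfun_dbas -[RHS](sum_kronr (g, h) (fun p => r h g * X p)).
apply: eq_bigr => -[x y] _; rewrite e dbl_scaleE dbasE !xpair_eqE !(inj_eq perm_inj).
have [->|_] := eqVneq g x; last by rewrite !mulr0.
have [->|_] := eqVneq h y; last by rewrite !mulr0.
by rewrite !mulr1 mulrC.
Qed.

Lemma haut_invE f X Y : f X = Y -> (f^-1)%g Y = X.
Proof. by move=> <-; rewrite -[LHS]comp_lfunE (_ : (_ \o _)%VF = (f^-1 * f)%g) // mulVg id_lfunE. Qed.

Lemma haut_mulE f f' X : (f * f')%g X = f (f' X).
Proof. exact: comp_lfunE. Qed.

Lemma haut_dbasP f f' : (forall g h, f (dbas k (g, h)) = f' (dbas k (g, h))) -> f = f'.
Proof. by move=> e; apply/val_inj/lfun_dbasP => -[g h]; apply: e. Qed.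

Lemma kform_invE r w v f g h : r h g != 0 -> kform r w v f ->
  (f^-1)%g (dbas k (w g, v h)) = (r h g)^-1 *: dbas k (g, h).
Proof. by move=> r0 e; apply: haut_invE; rewrite linearZ /= e scalerA mulVf // scale1r. Qed.

(** Serves the closure of K and of both its factors; the formula for [r''] is kept because
    SpAut_c(G) needs it to be 1. *)
Lemma kform_div r r' w w' v v' f f' : kdata r w v -> kdata r' w' v' ->
  kform r w v f -> kform r' w' v' f' -> exists2 r'',
    kdata r'' (w'^-1 * w)%g (v'^-1 * v)%g /\
    (forall h g, r'' (v' h) (w' g) = (r' h g)^-1 * r h g) &
    kform r'' (w'^-1 * w)%g (v'^-1 * v)%g (f * f'^-1)%g.
Proof.
move=> [r0 rMl rMr wM vM cj] [r0' rMl' rMr' wM' vM' cj'] e e'.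
have wVM : {morph (w'^-1)%g : x y / (x * y)%g}.
  by move=> x y; apply: (@perm_inj _ w'); rewrite wM' !permKV.
have vVM : {morph (v'^-1)%g : x y / (x * y)%g}.
  by move=> x y; apply: (@perm_inj _ v'); rewrite vM' !permKV.
pose r'' h g := (r' ((v'^-1)%g h) ((w'^-1)%g g))^-1 * r ((v'^-1)%g h) ((w'^-1)%g g).
exists r''.
  split; last by move=> h g; rewrite /r'' !permK.
  split=> [h g|h h' g|h g g'|x y|x y|g h]; rewrite /r''.
  - by rewrite mulf_neq0 ?invr_eq0 ?r0 ?r0'.
  - by rewrite vVM rMl rMl' invfM mulrACA.
  - by rewrite wVM rMr rMr' invfM mulrACA.
  - by rewrite !permM wVM wM.
  - by rewrite !permM vVM vM.
  rewrite !permM -cj; congr (w _).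
  by apply: (@perm_inj _ w'); rewrite permKV cj' !permKV.
move=> g h; rewrite haut_mulE -{1}[g](permKV w') -{1}[h](permKV v').
by rewrite (kform_invE _ e') // linearZ /= e scalerA !permM.
Qed.

Lemma kdata1 : kdata (fun _ _ => 1) 1%g 1%g.
Proof.
by split=> [h g|h h' g|h g g'|x y|x y|g h]; rewrite ?oner_eq0 ?mulr1 ?perm1.
Qed.

Lemma kform1 : kform (fun _ _ => 1) 1%g 1%g (1%g : haut k gT).
Proof. by move=> g h; rewrite id_lfunE scale1r !perm1. Qed.

Section KChar.
Hypothesis hG : purely_nonabelian gT.

Lemma comp_v_perm f R Q : glike_action f R Q -> exists v, Q one =1 v.
Proof.
move=> RQ; have [psiH _] := hautP f; have [psiH' _] := hautP (f^-1)%g.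
have [R' [Q' RQ']] := hopf_endo_glike psiH'.
have psiK X : (f^-1)%g (f X) = X :> dbl by apply: haut_invE.
have v_inj := act_v_inj psiH' psiH psiK RQ' RQ hG.
by exists (perm v_inj) => x; rewrite permE.
Qed.

(** With p trivial, psi(e_g # 1) = u(e_g) # 1, so u is an algebra endomorphism of k^G: the pullback
    along a self-map of G, whose inverse is [w]. *)
Lemma KAutP f : KAut k gT f <-> exists r w v, kdata r w v /\ kform r w v f.
Proof.
split=> [tp|[r [w [v [[r0 rMl rMr wM vM cj] e]]]] a]; last first.
  apply/ffunP=> h; rewrite ffunE.
  have := kformE (smash a (delta k 1%g)) 1%g ((v^-1)%g h) e.
  rewrite (perm_morph1 wM) permKV => ->; rewrite smashE !ffunE.
  have -> : r ((v^-1)%g h) 1%g = 1.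
    by apply: (mulfI (r0 ((v^-1)%g h) 1%g)); rewrite -rMr mulg1 mulr1.
  have v1 : (v^-1)%g 1%g = 1%g by rewrite -{1}(perm_morph1 vM) permK.
  by rewrite mul1r -[in RHS](inj_eq (@perm_inj _ (v^-1)%g)) v1.
have [psiH [fi fK fiK]] := hautP f.
have [R [Q RQ]] := hopf_endo_glike psiH; have [v vE] := comp_v_perm RQ.
have PE g s : Pc f g s = (g == 1%g)%:R * (s == 1%g)%:R.
  have /ffunP/(_ s) := tp (delta k g); rewrite !ffunE => e.
  by apply: (etrans e); rewrite eq_sym.
have XE g x s : Xc f g (x, s) = Uc f g x * (s == 1%g)%:R :> k.
  rewrite (Xc_UP psiH) -(sum_kronr g (fun c => Uc f c x * (s == 1%g)%:R)).
  apply: eq_bigr => c _; rewrite PE -eq_mulgV1 eq_sym -mulrA; congr (_ * _).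
  by rewrite mulrC.
have exu x : exists u, forall g, Uc f g x = (g == u)%:R.
  apply: idempotent_family => [|g g'].
    transitivity (\sum_g Xc f g (x, 1%g)); last by rewrite (Xc_unit psiH) eqxx.
    by apply: eq_bigr => g _; rewrite XE eqxx mulr1.
  have /ffunP/(_ (x, 1%g)) := Xc_mul psiH g g'; rewrite dmulE dbl_scaleE XE eqxx mulr1.
  move=> <-; rewrite (bigD1 1%g) //= big1 ?addr0 => [|c /negPf c1].
    by rewrite invg1 !XE mul1g mulg1 mul1g eqxx !mulr1.
  by rewrite XE c1 mulr0 mul0r.
have [u uE] := boolp.choice exu.
have uM x y : u (x * y)%g = (u x * u y)%g.
  have := Uc_comul psiH (u x * u y)%g y x; under eq_bigr => c _ do rewrite !uE.
  rewrite uE sum_kronl mulgK eqxx; case: eqP => // _ /esym/eqP.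
  by rewrite oner_eq0.
(* If [g] were not a value of [u], the injective map [f] would kill e_g # 1. *)
have exw g : exists x, u x = g.
  apply: contrapT => /forallNP nex.
  have X0 : Xc f g = 0.
    apply/ffunP=> -[x s]; rewrite XE uE ffunE; case: eqP => [e|_]; last by rewrite mul0r.
    by case: (nex x).
  have := fK (dbas k (g, 1%g)); rewrite -/(Xc f g) X0.
  rewrite -[in X in X = _](linear0 f) fK => /ffunP/(_ (g, 1%g)).
  by rewrite dbasE eqxx ffunE => /esym/eqP; rewrite oner_eq0.
have [w0 w0K] := boolp.choice exw.
have w0_inj : injective w0 := can_inj w0K.
pose w := perm w0_inj.
have uw x : (w (u x)) = x.
  have [wi _ wiK] := injF_bij w0_inj.
  by rewrite permE -[x in u x]wiK w0K wiK.
have wu x : u (w x) = x by rewrite permE w0K.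
have fE g h x y : f (dbas k (g, h)) (x, y) = (x == w g)%:R * (y == v h)%:R * R one h x :> k.
  rewrite (psi_dbasE psiH RQ) XE uE vE -eq_mulgV1; congr ((nat_of_bool _)%:R * _ * _).
  by apply/eqP/eqP => [->|->].
exists (fun h g => R one h (w g)), w, v; split.
  have wM : {morph w : x y / (x * y)%g}.
    by move=> x y; rewrite -[RHS]uw uM !wu.
  split=> //.
  - by move=> h g; apply: act_r0 RQ _ _.
  - by move=> h h' g; apply: (act_rMl psiH RQ).
  - by move=> h g g'; rewrite wM (act_rMr RQ).
  - by move=> x y; rewrite -!vE (act_vM psiH RQ).
  move=> g h; have := Xc_equiv psiH RQ (h^-1 * g * h)%g h (w g) 1%g.
  rewrite mulg1 mulVg !XE !uE eqxx !mulr1 vE wu.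
  rewrite !mulgA mulgV mul1g mulgK eqxx; case: eqP => [e _|_ /esym/eqP]; last by rewrite oner_eq0.
  by rewrite e uw.
move=> g h; apply/ffunP=> -[x y]; rewrite fE dbl_scaleE dbasE xpair_eqE.
rewrite -natrM mulnb; case: eqP => [->|]; rewrite /= ?mul0r ?mulr0 //.
by rewrite mulrC.
Qed.

End KChar.
End Factorization.

(** * Lambda(G) and the factorization of an automorphism *)

Section LambdaPart.
Variables (k : fieldType) (gT : finGroupType).
Implicit Types (g h s t x y : gT) (P : gT -> gT -> k).
Local Notation kfun := {ffun gT -> k^o}.
Local Notation dbl := {ffun gT * gT -> k^o}.
Local Notation glike chi h := (smash chi (delta k h) : dbl).
Local Notation one := (kone k gT).
Implicit Types f : haut k gT.

(** Conditions on components become conditions on the whole map, which pass at once to products and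
    inverses. *)
Lemma LambdaP f : Lambda k gT f <->
  (forall (X : dbl) x, \sum_y f X (x, y) = \sum_y X (x, y) :> k) /\
  (forall h, f (glike one h) = glike one h).
Proof.
split=> [[fu fv fr]|[fs fg]]; last first.
  split=> [a|h|h].
  - apply/ffunP=> x; rewrite ffunE fs.
    by under eq_bigr => y _ do rewrite glikeE; rewrite sum_kronr.
  - by apply/ffunP=> y; rewrite !ffunE fg !ffunE mul1r.
  apply/ffunP=> x; rewrite ffunE fg.
  by under eq_bigr => y _ do rewrite glikeE; rewrite sum_kronr.
have [psiH _] := hautP f; have [R [Q RQ]] := hopf_endo_glike psiH.
have rE h : R one h = one by rewrite -(comp_rE RQ).
have vE h : Q one h = h.
  have := fv h; rewrite (comp_vE RQ) => /ffunP/(_ h); rewrite !ffunE eqxx eq_sym.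
  by case: eqP => // _ /esym/eqP; rewrite oner_eq0.
split=> [X x|h]; last by have [_ ->] := RQ one h (dual_kone k gT); rewrite rE vE.
under eq_bigr => y _ do rewrite lfun_dbas sum_pair.
rewrite exchange_big /=.
rewrite -[RHS](sum_kronr x (fun g => \sum_h X (g, h))); apply: eq_bigr => g _.
rewrite exchange_big /= mulr_suml; apply: eq_bigr => h _.
rewrite -mulr_sumr (psi_dbas_sum psiH RQ) rE koneE mulr1; congr (_ * _).
have /ffunP/(_ x) := fu (delta k g); rewrite !ffunE => e.
by apply: (etrans e); rewrite eq_sym.
Qed.

Section Lam.
Variables (P : gT -> gT -> k) (hP : central_hopf_map P).

Definition lamaut : haut k gT := mkhaut (hopf_aut_lam hP).

Lemma lamaut_dbas g h x y :
  lamaut (dbas k (g, h)) (x, y) = P (g * x^-1)%g (y * h^-1)%g :> k.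
Proof.
rewrite lamE.
transitivity (\sum_z \sum_s (z == g * x^-1)%g%:R * ((s == y * h^-1)%g%:R * P z s)).
  apply: eq_bigr => z _; apply: eq_bigr => s _; rewrite [RHS]mulrA [RHS]mulrC -natrM mulnb.
  apply: (chm_eq hP) => cz _; rewrite dbasE xpair_eqE; congr (nat_of_bool (_ && _))%:R.
    by rewrite -cz; apply/eqP/eqP => [<-|->]; rewrite ?mulgK ?mulgKV.
  by apply/eqP/eqP => [<-|->]; rewrite ?invMg ?invgK ?mulKVg ?mulgKV.
by under eq_bigr => z _ do rewrite -mulr_sumr sum_kronl; rewrite sum_kronl.
Qed.

Lemma lamaut_Lambda : Lambda k gT lamaut.
Proof.
apply/LambdaP; split=> [X x|h].
  under eq_bigr => y _ do rewrite lamE.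
  rewrite exchange_big -[x in RHS]mulg1 -(chm_counit_sum hP (fun z => \sum_y X (x * z, y)%g)).
  apply: eq_bigr => z _ /=; rewrite exchange_big; apply: eq_bigr => s _ /=.
  rewrite -mulr_sumr [in RHS](reindex_inj (mulgI s^-1%g)).
  by [].
apply/ffunP=> -[x y]; rewrite lamE glikeE koneE mul1r exchange_big /=.
transitivity (\sum_s (s == 1%g)%:R * (s^-1 * y == h)%g%:R : k).
  apply: eq_bigr => s _; rewrite -(chm_unit hP) mulr_suml.
  by apply: eq_bigr => z _; rewrite glikeE koneE mul1r.
by rewrite sum_kronl invg1 mul1g.
Qed.

End Lam.

Lemma lamaut_inj P P' (hP : central_hopf_map P) (hP' : central_hopf_map P') :
  lamaut hP = lamaut hP' -> forall z s, P z s = P' z s.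
Proof.
move=> e z s; have := lamaut_dbas hP z 1%g 1%g s.
by rewrite e lamaut_dbas invg1 !mulg1.
Qed.

Section Nonabelian.
Hypothesis hG : purely_nonabelian gT.

Lemma Lambda_lamaut f : Lambda k gT f -> f = lamaut (Pc_central_hopf f hG).
Proof.
move=> /LambdaP[fs fg]; have [psiH _] := hautP f.
have [R [Q RQ]] := hopf_endo_glike psiH.
have [rE vE] : (forall h, R one h = one) /\ (forall h, Q one h = h).
  by split=> h; have [d] := RQ one h (dual_kone k gT); rewrite fg => /(glike_inj (dual_kone k gT))[].
apply: haut_dbasP => g h; apply/ffunP=> -[x y].
rewrite lamaut_dbas (psi_dbasE psiH RQ) rE vE koneE mulr1 (Xc_UP psiH).
rewrite -[RHS](sum_kronl x (fun c => Pc f (g * c^-1)%g (y * h^-1)%g)).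
apply: eq_bigr => c _; congr (_ * _); rewrite /Uc fs.
rewrite -[RHS](@sum_kronr k gT 1%g (fun=> (c == x)%:R)); apply: eq_bigr => s _.
by rewrite dbasE xpair_eqE -mulnb natrM eq_sym.
Qed.

(** The new matrix is that of v^-1 p. *)
Lemma chm_comp P (v : {perm gT}) : {morph v : x y / (x * y)%g} ->
  central_hopf_map P -> central_hopf_map (fun g s => P g (v s)).
Proof.
move=> vM hP; have v1 s : (v s == 1%g) = (s == 1%g).
  by rewrite -{1}(perm_morph1 vM) (inj_eq perm_inj).
split=> [s|z z' t|z|w s s'|z s|z s].
- by rewrite (chm_unit hP) v1.
- rewrite -(chm_mul hP) [RHS](reindex_inj (@perm_inj _ v)).
  by apply: eq_bigr => s _; rewrite vM perm_morphV.
- by rewrite -(chm_counit hP) [RHS](reindex_inj (@perm_inj _ v)).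
- by rewrite (chm_comul hP) (inj_eq perm_inj).
- by rewrite perm_morphV // (chm_antipode hP).
move=> /(chm_central hP)[cz cs]; split=> // g.
by apply: (@perm_inj _ v); rewrite !vM cs.
Qed.

Lemma factor_K_Lambda f : exists kap lmb,
  [/\ KAut k gT kap, Lambda k gT lmb & f = (kap * lmb)%g].
Proof.
have [psiH _] := hautP f; have [R [Q RQ]] := hopf_endo_glike psiH.
have [v vE] := comp_v_perm hG RQ.
have vM : {morph v : x y / (x * y)%g} by move=> x y; rewrite -!vE (act_vM psiH RQ).
have hP := chm_comp vM (Pc_central_hopf f hG).
(* The kG-component of [f] is that of [lamaut hP] followed by [v]. Hence the kG-component of the
   quotient is ev_1 followed by [v], and its p is trivial. *)
have fE X t : f X (1%g, v t) = lamaut hP X (1%g, t) :> k.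
  rewrite !lfun_dbas; apply: eq_bigr => -[g h] _; congr (_ * _).
  have [d _] := RQ one h (dual_kone k gT).
  rewrite lamaut_dbas (psi_dbasE psiH RQ) dual_1 // mulr1 invg1 mulg1 vE.
  by rewrite vM perm_morphV.
exists (f * (lamaut hP)^-1)%g, (lamaut hP); split.
- move=> a; apply/ffunP=> h; rewrite ffunE haut_mulE -[h in (_, h)](permKV v) fE.
  rewrite (_ : lamaut hP _ = smash a (delta k 1%g)); last first.
    by rewrite -haut_mulE mulgV id_lfunE.
  rewrite smashE !ffunE -[in RHS](inj_eq (@perm_inj _ (v^-1)%g)); congr (_ * (_ == _)%:R).
  by rewrite -{2}(perm_morph1 vM) permK.
- exact: lamaut_Lambda.
by rewrite mulgKV.
Qed.

Lemma KAut_Lambda f : KAut k gT f -> Lambda k gT f -> f = 1%g.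
Proof.
move=> /(KAutP hG)[r [w [v [rwv e]]]] /LambdaP[fs fg].
have key g h : w g = g /\ r h g = 1.
  (* At the point [w g] one sum is [r h g], which is nonzero, and the other is the indicator of
     [w g = g]. *)
  have := fs (dbas k (g, h)) (w g).
  under eq_bigr => y _ do rewrite e dbl_scaleE dbasE xpair_eqE eqxx /=.
  rewrite sum_kronr.
  under eq_bigr => y _ do rewrite dbasE xpair_eqE -mulnb natrM.
  rewrite -mulr_sumr sum_kron mulr1 => e1; have := kd_r0 rwv h g; rewrite e1.
  by case: (w g =P g) => //; rewrite eqxx.
have vh h : v h = h.
  have := kformE (glike one h) 1%g h e; rewrite fg !glikeE !koneE !mul1r eqxx.
  rewrite (key 1%g h).2 mulr1; case: eqP => // _ /esym/eqP; by rewrite oner_eq0.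
apply: haut_dbasP => g h.
by rewrite e (key g h).1 (key g h).2 vh scale1r id_lfunE.
Qed.

End Nonabelian.
End LambdaPart.

(** * Subgroups, the semidirect product and the exact factorizations *)

Section Subgroups.
Variables (k : fieldType) (gT : finGroupType).
Implicit Types (g h s t x y : gT) (r : gT -> gT -> k) (w v : {perm gT}).
Implicit Types f : haut k gT.
Hypothesis hG : purely_nonabelian gT.
Local Notation rone := (fun _ _ : gT => 1 : k).

Lemma Hom_dual_kdata (r : {ffun gT -> {ffun gT -> k^o}}) w v : Hom_dual k gT r ->
  w \in Aut [set: gT]%SET -> v \in Aut [set: gT]%SET -> (v * w^-1)%g \in Autc gT ->
  @kdata k gT (fun h g => r h g) w v.
Proof.
move=> [rd rM] /AutTP wM /AutTP vM /(AutcP wM vM) cj; split=> //.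
- by move=> h g; have [] := rd h.
- by move=> h g g'; have [] := rd h.
Qed.

Lemma kdata_Hom_dual r w v : kdata r w v -> Hom_dual k gT [ffun h => [ffun g => r h g]].
Proof.
move=> [r0 rMl rMr _ _ _]; split=> [h|h h' g]; last by rewrite !ffunE rMl.
by split=> [g|g g']; rewrite !ffunE ?rMr.
Qed.

Lemma kdata_Aut r w v : kdata r w v ->
  [/\ w \in Aut [set: gT]%SET, v \in Aut [set: gT]%SET & (v * w^-1)%g \in Autc gT].
Proof. by move=> [_ _ _ wM vM cj]; split; [exact/AutTP|exact/AutTP|exact/AutcP]. Qed.

Lemma kdata_wv r w v : kdata r w v -> kdata rone w v.
Proof. by move=> [_ _ _ wM vM cj]; split=> // *; rewrite ?oner_eq0 ?mulr1. Qed.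

Lemma kdata_r r w v : kdata r w v -> kdata r 1%g 1%g.
Proof. by move=> [? ? ? _ _ _]; split=> // [x y|x y|g h]; rewrite !perm1. Qed.

Lemma SpAutcP f : SpAutc k gT f <->
  exists w v, kdata rone w v /\ kform rone w v f.
Proof.
split=> [[w [v [wA vA cA e]]]|[w [v [d e]]]]; exists w, v.
  split=> [|g h]; last by rewrite e scale1r.
  move/AutTP: wA => wM; move/AutTP: vA => vM.
  have /(AutcP wM vM) cj := cA.
  by split=> // *; rewrite ?oner_eq0 ?mulr1.
by have [wA vA cA] := kdata_Aut d; split=> // g h; rewrite e scale1r.
Qed.

Lemma HomAutP f : HomAut k gT f <-> exists r, kdata r 1%g 1%g /\ kform r 1%g 1%g f.
Proof.
split=> [[r rH e]|[r [d e]]].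
  exists (fun h g => r h g); split=> [|g h]; last by rewrite e !perm1.
  apply: (Hom_dual_kdata rH); rewrite ?group1 // invg1 mulg1 inE group1.
  by apply/forallP=> g; rewrite perm1 mulgV group1.
exists [ffun h => [ffun g => r h g]]; first exact: kdata_Hom_dual d.
by move=> g h; rewrite e !ffunE !perm1.
Qed.

Lemma SpAutc_KAut f : SpAutc k gT f -> KAut k gT f.
Proof. by move=> /SpAutcP[w [v d]]; apply/KAutP => //; exists rone, w, v. Qed.

Lemma HomAut_KAut f : HomAut k gT f -> KAut k gT f.
Proof. by move=> /HomAutP[r d]; apply/KAutP => //; exists r, 1%g, 1%g. Qed.

Lemma group_closedP (S : set (haut k gT)) : S 1%g ->
  (forall f f', S f -> S f' -> S (f * f'^-1)%g) -> group_closed [in S].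
Proof.
move=> S1 SM; split; first by rewrite /= in_setE.
by move=> f f'; rewrite /= !in_setE; apply: SM.
Qed.

Lemma group_closed_set (S : set (haut k gT)) : group_closed [in S] ->
  [/\ S 1%g, forall f f', S f -> S f' -> S (f * f')%g & forall f, S f -> S (f^-1)%g].
Proof.
move=> gS; have [S1 _] := gS; have SM := group_closedM gS; have SV := group_closedV gS.
split=> [|f f' Sf Sf'|f Sf]; first by move: S1; rewrite /= in_setE.
  by have := SM f f'; rewrite /= !in_setE; apply.
by have := SV f; rewrite /= !in_setE; apply.
Qed.

Lemma KAut_closed : group_closed [in KAut k gT].
Proof.
apply: group_closedP.
  by apply/KAutP => //; exists rone, 1%g, 1%g; split; [exact: kdata1|exact: kform1].
move=> f f' /(KAutP hG)[r [w [v [d e]]]] /(KAutP hG)[r' [w' [v' [d' e']]]].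
have [r'' [d'' _] e''] := kform_div d d' e e'.
by apply/KAutP => //; exists r'', (w'^-1 * w)%g, (v'^-1 * v)%g.
Qed.

Lemma SpAutc_closed : group_closed [in SpAutc k gT].
Proof.
apply: group_closedP.
  by apply/SpAutcP; exists 1%g, 1%g; split; [exact: kdata1|exact: kform1].
move=> f f' /SpAutcP[w [v [d e]]] /SpAutcP[w' [v' [d' e']]].
have [r'' [d'' re] e''] := kform_div d d' e e'.
apply/SpAutcP; exists (w'^-1 * w)%g, (v'^-1 * v)%g; split; first exact: kdata_wv d''.
move=> g h; rewrite e''; have := re ((v'^-1)%g h) ((w'^-1)%g g).
by rewrite !permKV => ->; rewrite invr1 mulr1.
Qed.

Lemma HomAut_closed : group_closed [in HomAut k gT].
Proof.
apply: group_closedP.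
  by apply/HomAutP; exists rone; split; [exact: kdata1|exact: kform1].
move=> f f' /HomAutP[r [d e]] /HomAutP[r' [d' e']].
have [r'' [d'' _] e''] := kform_div d d' e e'.
by apply/HomAutP; exists r''; move: d'' e''; rewrite invg1 mulg1.
Qed.

Lemma Lambda_closed : group_closed [in Lambda k gT].
Proof.
apply: group_closedP.
  by apply/LambdaP; split=> *; rewrite id_lfunE.
move=> f f' /LambdaP[fs fg] /LambdaP[fs' fg'].
apply/LambdaP; split=> [X x|h].
  rewrite haut_mulE fs -fs' -haut_mulE mulgV.
  by under eq_bigr => y _ do rewrite id_lfunE.
by rewrite haut_mulE (haut_invE (fg' h)) fg.
Qed.

Lemma KAut_semidirect :
  internal_semidirect (KAut k gT) (SpAutc k gT) (HomAut k gT).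
Proof.
split; [exact: KAut_closed|exact: SpAutc_closed|exact: HomAut_closed|split].
- exact: HomAut_KAut.
- move=> f n /(KAutP hG)[r [w [v [d e]]]] /HomAutP[rho [dn en]].
  have nE g h : (f * n * f^-1)%g (dbas k (w g, v h)) = rho h g *: dbas k (w g, v h).
    rewrite !haut_mulE (kform_invE _ e) ?(kd_r0 d) // !linearZ /= en !perm1 linearZ /= e.
    by rewrite !scalerA mulrAC mulVf ?mul1r ?(kd_r0 d).
  (* Conjugation by [f] transports the bicharacter along [v] and [w]; the scalars [r] cancel. *)
  pose rho' h g := rho ((v^-1)%g h) ((w^-1)%g g).
  apply/HomAutP; exists rho'; split; last first.
    by move=> g h; rewrite !perm1 -{1}[g](permKV w) -{1}[h](permKV v) nE !permKV.
  have [n0 nMl nMr _ _ _] := dn; have [_ _ _ wM vM _] := d.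
  have wVM : {morph (w^-1)%g : x y / (x * y)%g}.
    by move=> x y; apply: (@perm_inj _ w); rewrite wM !permKV.
  have vVM : {morph (v^-1)%g : x y / (x * y)%g}.
    by move=> x y; apply: (@perm_inj _ v); rewrite vM !permKV.
  apply: (@kdata_r _ 1%g 1%g); split=> [h g|h h' g|h g g'|x y|x y|g h]; rewrite /rho' ?perm1 //.
    by rewrite vVM.
  by rewrite wVM.
- apply/seteqP; split=> [f /(KAutP hG)[r [w [v [d e]]]]|f [s [n [Ks Kn ->]]]]; last first.
    have [_ KM _] := group_closed_set KAut_closed.
    by apply: KM; [exact: SpAutc_KAut|exact: HomAut_KAut].
  have ds := kdata_wv d; pose s := kaut ds; have es := kautE ds.
  exists s, (s^-1 * f)%g; split; last by rewrite mulKVg.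
    by apply/SpAutcP; exists w, v.
  apply/HomAutP; exists r; split; first exact: kdata_r d.
  move=> g h; rewrite haut_mulE e linearZ /= !perm1.
  by rewrite (kform_invE _ es) ?oner_eq0 // invr1 scale1r.
apply/seteqP; split=> [f [/SpAutcP[w [v [d e]]] /HomAutP[r [d' e']]]|_ ->]; last first.
  have [S1 _ _] := group_closed_set SpAutc_closed.
  by have [H1 _ _] := group_closed_set HomAut_closed.
have [re we ve] := kform_inj (fun _ _ => oner_neq0 k) e e'.
by apply: haut_dbasP => g h; rewrite e we ve scale1r !perm1 id_lfunE.
Qed.

Lemma KAut_Lambda_exact : exact_factorization (KAut k gT) (Lambda k gT).
Proof.
split; [exact: KAut_closed|exact: Lambda_closed| |].
  apply/seteqP; split=> f // _.
  by have [kap [lmb [? ? ?]]] := factor_K_Lambda hG f; exists kap, lmb.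
apply/seteqP; split=> [f []|_ ->]; first exact: KAut_Lambda.
have [S1 _ _] := group_closed_set KAut_closed.
by have [H1 _ _] := group_closed_set Lambda_closed.
Qed.

Lemma Lambda_KAut_exact : exact_factorization (Lambda k gT) (KAut k gT).
Proof.
have [cK cL _ KL1] := KAut_Lambda_exact; split=> //; last by rewrite setIC.
have [_ _ KV] := group_closed_set cK; have [_ _ LV] := group_closed_set cL.
apply/seteqP; split=> f // _.
have [kap [lmb [Kk Ll e]]] := factor_K_Lambda hG (f^-1)%g.
exists (lmb^-1)%g, (kap^-1)%g; split; [exact: LV|exact: KV|].
by rewrite -invMg -e invgK.
Qed.

End Subgroups.

(** * Counting the automorphisms *)

Section Counting.
Variables (k : closedFieldType) (gT : finGroupType).
Hypothesis char0 : [pchar k] =i pred0.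
Hypothesis hG : purely_nonabelian gT.
Local Notation ZG := ('Z([set: gT]%SET))%G.

(** All values are roots of unity of order dividing |G|. Finiteness is what makes [fset_set]
    represent this set faithfully in the cardinality formula. *)
Lemma Hom_dual_finite : finite_set (Hom_dual k gT).
Proof.
have n0 : (0 < #|gT|)%N by apply/card_gt0P; exists 1%g.
have [z zP] := prim_root_exists char0 n0.
pose F (phi : {ffun gT * gT -> 'I_#|gT|}) : {ffun gT -> {ffun gT -> k^o}} :=
  [ffun g => [ffun x => z ^+ phi (g, x)]].
apply: (@sub_finite_set _ _ (F @` [set: _])%classic); last first.
  exact: finite_image.
move=> r [rd _].
have rt g x : exists i : 'I_#|gT|, r g x == z ^+ i.
  have [r0 rM] := rd g; have rX n : r g (x ^+ n)%g = r g x ^+ n.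
    elim: n => [|n IHn]; last by rewrite expgS rM IHn exprS.
    exact: dual_1.
  have [|i e] := prim_rootP zP (x := r g x); last by exists i; apply/eqP.
  have x1 : (x ^+ #|gT| = 1)%g.
    by have := @expg_cardG _ [group of [set: gT]%SET] x; rewrite /= cardsT inE => ->.
  by rewrite -rX x1 dual_1.
exists [ffun p => xchoose (rt p.1 p.2)] => //.
by apply/ffunP=> g; apply/ffunP=> x; rewrite !ffunE; have /eqP := xchooseP (rt g x).
Qed.

Lemma card_haut : ([set: haut k gT] #=
  `I_(#|endos ZG| * #|` fset_set (Hom_dual k gT)| * #|Autc gT| *
      #|Aut [set: gT]%SET|)%N)%card.
Proof.
have [b [b0 bC] [bM bN]] := abelian_pairing char0 (center_abelian [group of [set: gT]%SET]).
have cardZ : #|ZG|%:R != 0 :> k.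
  by rewrite (iffLR (pcharf0P k) char0) -lt0n cardG_gt0.
(* Values off the centre are irrelevant, since [fourier] reads its argument only on Z. *)
pose F (f : {ffun subg_of ZG -> subg_of ZG}) y := sgval (f (subg ZG y)).
have FM f : f \in endos ZG -> {in ZG &, {morph F f : x y / (x * y)%g}}.
  move=> /[!inE] /forallP fM x y xZ yZ; rewrite /F subgM //.
  by have /forallP/(_ (subg ZG y))/eqP-> := fM (subg ZG x).
have FZ f y : y \in ZG -> F f y \in ZG by move=> _; apply: subgP.
have FH f : f \in endos ZG -> central_hopf_map (fourier b (F f)).
  by move=> fE; apply: fourier_hopf => //; [exact: FM|exact: FZ].
pose T := ({f | f \in endos ZG} * fset_set (Hom_dual k gT) *
  {a | a \in Autc gT} * {v | v \in Aut [set: gT]%SET})%type.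
have rH (r : fset_set (Hom_dual k gT)) : Hom_dual k gT (val r).
  by have := fsvalP r; rewrite (in_fset_set Hom_dual_finite) in_setE.
(* The pair (w, v) is parametrized by [v] and the central automorphism [a], equal to w^-1 o v; with
   products read from left to right, this gives [w] as [a^-1 * v]. *)
have kd (r : fset_set (Hom_dual k gT)) (a : {a | a \in Autc gT})
    (v : {v | v \in Aut [set: gT]%SET}) :
    @kdata k gT (fun h g => val r h g) ((val a)^-1 * val v)%g (val v).
  apply: (Hom_dual_kdata (rH r)); last by rewrite invMg invgK mulKVg (valP a).
    by rewrite groupM ?groupV ?(valP v) //; have := valP a; rewrite inE => /andP[].
  exact: valP v.
pose Phi (t : T) : haut k gT := let: (f, r, a, v) := t in
  (kaut (kd r a v) * lamaut (FH (val f) (valP f)))%g.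
have [_ KM KV] := group_closed_set (KAut_closed k hG).
have [_ LM LV] := group_closed_set (@Lambda_closed k gT).
have kK r a v : KAut k gT (kaut (kd r a v)).
  apply/(KAutP hG); exists (fun h g => val r h g), ((val a)^-1 * val v)%g, (val v).
  by split; [exact: kd|exact: kautE].
have Phi_inj : injective Phi.
  move=> [[[f r] a] v] [[[f' r'] a'] v'] /= e.
  pose kap := kaut (kd r a v); pose kap' := kaut (kd r' a' v').
  pose lmb := lamaut (FH (val f) (valP f)); pose lmb' := lamaut (FH (val f') (valP f')).
  (* This element lies in both K and Lambda(G), whose intersection is trivial. *)
  have e1 : (kap'^-1 * kap = lmb' * lmb^-1)%g.
    by apply: (mulgI kap'); rewrite mulKVg mulgA -e mulgK.
  have e2 : (kap'^-1 * kap)%g = 1%g.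
    apply: (KAut_Lambda hG); first by apply: KM; [apply: KV|]; apply: kK.
    by rewrite e1; apply: LM; [|apply: LV]; apply: lamaut_Lambda.
  have ek : kap = kap' by rewrite -[LHS](mulKVg kap') e2 mulg1.
  have el : lmb = lmb' by move: e; rewrite -/kap -/kap' ek => /mulgI.
  have := kautE (kd r a v); rewrite -/kap ek => ke.
  have [re we ve] := kform_inj (kd_r0 (kd r a v)) ke (kautE (kd r' a' v')).
  have -> : v = v' by apply: val_inj.
  have -> : a = a'.
    by apply: val_inj; move: we; rewrite ve => /mulIg/invg_inj.
  have -> : r = r' by apply: val_inj; apply/ffunP=> h; apply/ffunP=> g; apply: re.
  have -> // : f = f'; apply: val_inj; apply/ffunP=> y.
  apply: subg_inj; have := fourier_inj b0 bC bM bN cardZ (lamaut_inj el) (subgP y).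
  by rewrite /F sgvalK.
have Phi_surj : [set: haut k gT]%classic = (Phi @` [set: T])%classic.
  apply/seteqP; split=> // psi _.
  have [kap [lmb [Kk Ll ->]]] := factor_K_Lambda hG psi.
  have [r [w [v [d e]]]] := (KAutP hG kap).1 Kk.
  have [wA vA aA] := kdata_Aut d.
  have rh : [ffun h => [ffun g => r h g]] \in fset_set (Hom_dual k gT).
    by rewrite (in_fset_set Hom_dual_finite) in_setE; apply: kdata_Hom_dual d.
  have [F0 [F0M F0Z F0E]] := fourier_surj b0 bC bM bN cardZ (Pc_central_hopf lmb hG).
  pose f : {ffun subg_of ZG -> subg_of ZG} := [ffun y => subg ZG (F0 (sgval y))].
  have fE : f \in endos ZG.
    rewrite inE; apply/forallP=> x; apply/forallP=> y; rewrite !ffunE.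
    by rewrite -subgM ?F0Z ?subgP // -F0M ?subgP.
  exists (Sub f fE, FSetSub rh, Sub (v * w^-1)%g aA, Sub v vA) => //=.
  congr (_ * _)%g.
    apply: haut_dbasP => g h; rewrite kautE e /= !ffunE.
    by rewrite invMg invgK mulgKV.
  rewrite [RHS](Lambda_lamaut hG Ll); apply: haut_dbasP => g h; apply/ffunP=> -[x y].
  rewrite !lamaut_dbas -F0E /=; congr (_ * (_ * _)); apply: eq_bigr => z zZ.
  by rewrite /F ffunE !subgK ?F0Z.
have -> : (#|endos ZG| * #|` fset_set (Hom_dual k gT)| * #|Autc gT| *
      #|Aut [set: gT]%SET|)%N = #|{: T}|.
  by rewrite !card_prod !card_sig cardfE.
rewrite Phi_surj; apply: card_eq_trans (inj_card_eq _) _; first by move=> ? ? _ _; apply: Phi_inj.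
rewrite card_eq_sym; apply: card_eq_trans card_II _.
rewrite (_ : [set: T]%classic = (@enum_val T predT @` [set: _])%classic).
  by rewrite card_eq_sym; apply: inj_card_eq => ? ? _ _; apply: enum_val_inj.
apply/seteqP; split=> // t _; exists (enum_rank t) => //; exact: enum_rankK.
Qed.

End Counting.

Local Open Scope classical_set_scope.
Local Open Scope card_scope.

Theorem theorem5p7 (k : closedFieldType) (hk : [pchar k] =i pred0)
    (gT : finGroupType) (hG : purely_nonabelian gT) :
  let G := [group of [set: gT]%SET] in
  [/\ internal_semidirect (KAut k gT) (SpAutc k gT) (HomAut k gT),
      exact_factorization (Lambda k gT) (KAut k gT),
      exact_factorization (KAut k gT) (Lambda k gT)
    & [set: haut k gT] #=
        `I_(#|endos 'Z(G)%G| * #|` fset_set (Hom_dual k gT)|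
            * #|Autc gT| * #|Aut G|)%N].
Proof.
split; [exact: KAut_semidirect | exact: Lambda_KAut_exact
       | exact: KAut_Lambda_exact | exact: card_haut].
Qed.
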